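(* Let $\mathbb C$ carry the structure of an abstract model of the calculus $\lambda_{[\tau]}$, as described in the context. Then the interpretation of $\lambda_{[\tau]}$ in $\mathbb C$ is sound for the equational theory of $\lambda_{[\tau]}$: if $\Gamma\vdash V\equiv W:X$ is derivable, then $[\![V]\!]=[\![W]\!]:[\![\Gamma]\!]\mathbb 1\to[\![X]\!]$; and if $\Gamma\vdash M\equiv N:X\,!\,\tau$ is derivable, then $[\![M]\!]=[\![N]\!]:[\![\Gamma]\!]\mathbb 1\to T\,\tau\,[\![X]\!]$.
   Context: **Syntax and typing.** Time grades are $\tau\in\mathbb N$; $\dot-$ is truncated subtraction. Fix base types $b$. Ground types: $A,B::=b\mid\mathsf{unit}\mid A\times B\mid[\tau]A$. Value types: $X,Y,Z::=A\mid X\times Y\mid X\to Y\,!\,\tau\mid[\tau]X$. Computation types: $X\,!\,\tau$. Fix constants $f:(A_1,\dots,A_n)\to B$ (ground types) and a set $\mathcal O$ of operation symbols, each with a signature $\mathsf{op}:A_{\mathsf{op}}\leadsto B_{\mathsf{op}}\,!\,\tau_{\mathsf{op}}$ ($A_{\mathsf{op}},B_{\mathsf{op}}$ ground, $\tau_{\mathsf{op}}\in\mathbb N$). Values: $V,W::=x\mid f(V_1,\dots,V_n)\mid()\mid(V,W)\mid\mathsf{fun}\,(x:X)\mapsto M\mid\mathsf{box}_\tau V$. Computations: $M,N,P::=\mathsf{return}\,V\mid\mathsf{let}\,x=M\,\mathsf{in}\,N\mid V\,W\mid\mathsf{match}\,V\,\mathsf{with}\,\{(x,y)\mapsto N\}\mid\mathsf{op}\,V\,(x.M)\mid\mathsf{delay}\,\tau\,M\mid\mathsf{handle}\,M\,\mathsf{with}\,H\,\mathsf{to}\,x\,\mathsf{in}\,N\mid\mathsf{unbox}_\tau\,V\,\mathsf{as}\,x\,\mathsf{in}\,N$.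 Handlers: $H=(x.k.M_{\mathsf{op}})_{\mathsf{op}\in\mathcal O}$. Terms are up to $\alpha$-equivalence. Contexts: $\Gamma::=\cdot\mid\Gamma,x{:}X\mid\Gamma,\langle\tau\rangle$, with distinct variables. $\mathsf{time}(\cdot)=0$, $\mathsf{time}(\Gamma,x{:}X)=\mathsf{time}\,\Gamma$, $\mathsf{time}(\Gamma,\langle\tau\rangle)=\mathsf{time}\,\Gamma+\tau$. $\Gamma-0=\Gamma$; for $\tau\ge1$: $\cdot-\tau=\cdot$; $(\Gamma,x{:}X)-\tau=\Gamma-\tau$; $(\Gamma,\langle\tau'\rangle)-\tau=\Gamma,\langle\tau'\dot-\tau\rangle$ if $\tau\le\tau'$, and $\Gamma-(\tau\dot-\tau')$ otherwise. Typing rules (premises $\Rightarrow$ conclusion). Var: $\Gamma,x{:}X,\Gamma'\vdash x:X$. Const: $\Gamma\vdash V_i:A_i$ for all $i$ $\Rightarrow$ $\Gamma\vdash f(V_1,\dots,V_n):B$. Unit: $\Gamma\vdash():\mathsf{unit}$. Pair: $\Gamma\vdash V:X$, $\Gamma\vdash W:Y$ $\Rightarrow$ $\Gamma\vdash(V,W):X\times Y$. Fun: $\Gamma,x{:}X\vdash M:Y\,!\,\tau$ $\Rightarrow$ $\Gamma\vdash\mathsf{fun}\,(x:X)\mapsto M:X\to Y\,!\,\tau$. Box: $\Gamma,\langle\tau\rangle\vdash V:X$ $\Rightarrow$ $\Gamma\vdash\mathsf{box}_\tau V:[\tau]X$. Return: $\Gamma\vdash V:X$ $\Rightarrow$ $\Gamma\vdash\mathsf{return}\,V:X\,!\,0$.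 Let: $\Gamma\vdash M:X\,!\,\tau$, $\Gamma,\langle\tau\rangle,x{:}X\vdash N:Y\,!\,\tau'$ $\Rightarrow$ $\Gamma\vdash\mathsf{let}\,x=M\,\mathsf{in}\,N:Y\,!\,(\tau+\tau')$. Apply: $\Gamma\vdash V:X\to Y\,!\,\tau$, $\Gamma\vdash W:X$ $\Rightarrow$ $\Gamma\vdash V\,W:Y\,!\,\tau$. Match: $\Gamma\vdash V:X\times Y$, $\Gamma,x{:}X,y{:}Y\vdash N:Z\,!\,\tau$ $\Rightarrow$ $\Gamma\vdash\mathsf{match}\,V\,\mathsf{with}\,\{(x,y)\mapsto N\}:Z\,!\,\tau$. Op: $\Gamma\vdash V:A_{\mathsf{op}}$, $\Gamma,\langle\tau_{\mathsf{op}}\rangle,x{:}B_{\mathsf{op}}\vdash M:X\,!\,\tau$ $\Rightarrow$ $\Gamma\vdash\mathsf{op}\,V\,(x.M):X\,!\,(\tau_{\mathsf{op}}+\tau)$. Delay: $\Gamma,\langle\tau\rangle\vdash M:X\,!\,\tau'$ $\Rightarrow$ $\Gamma\vdash\mathsf{delay}\,\tau\,M:X\,!\,(\tau+\tau')$. Handle: $\Gamma\vdash M:X\,!\,\tau$; $\Gamma,\langle\tau\rangle,x{:}X\vdash N:Y\,!\,\tau'$; and for every $\mathsf{op}\in\mathcal O$ and every $\tau''\in\mathbb N$, $\Gamma,x{:}A_{\mathsf{op}},k{:}[\tau_{\mathsf{op}}](B_{\mathsf{op}}\to Y\,!\,\tau'')\vdash M_{\mathsf{op}}:Y\,!\,(\tau_{\mathsf{op}}+\tau'')$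 $\Rightarrow$ $\Gamma\vdash\mathsf{handle}\,M\,\mathsf{with}\,H\,\mathsf{to}\,x\,\mathsf{in}\,N:Y\,!\,(\tau+\tau')$, where $H=(x.k.M_{\mathsf{op}})_{\mathsf{op}\in\mathcal O}$. Unbox: $\tau\le\mathsf{time}\,\Gamma$, $\Gamma-\tau\vdash V:[\tau]X$, $\Gamma,x{:}X\vdash N:Y\,!\,\tau'$ $\Rightarrow$ $\Gamma\vdash\mathsf{unbox}_\tau\,V\,\mathsf{as}\,x\,\mathsf{in}\,N:Y\,!\,\tau'$. Typing derivations are unique. **Equational theory.** The judgements $\Gamma\vdash V\equiv W:X$ and $\Gamma\vdash M\equiv N:X\,!\,\tau$ (both sides presupposed well-typed in the given context at the given type) are generated by the equivalence rules, congruence rules for all term formers (for handlers: clause-wise, for every $\mathsf{op}$ and $\tau''$), substitutivity (if $\Gamma,x{:}X,\Gamma'\vdash I\equiv J$ and $\Gamma\vdash W:X$ then $\Gamma,\Gamma'\vdash I[W/x]\equiv J[W/x]$), and the axioms: - $()\equiv V:\mathsf{unit}$; $\ \mathsf{fun}\,(x:X)\mapsto V\,x\equiv V:X\to Y\,!\,\tau$; $\ (\mathsf{fun}\,(x:X)\mapsto M)\,V\equiv M[V/x]$; - $\mathsf{match}\,(V,W)\,\mathsf{with}\,\{(x,y)\mapsto N\}\equiv N[V/x,W/y]$; $\ \mathsf{match}\,V\,\mathsf{with}\,\{(x,y)\mapsto N[(x,y)/z]\}\equiv N[V/z]$; - $\mathsf{let}\,x=(\mathsf{return}\,V)\,\mathsf{in}\,N\equiv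 N[V/x]$; $\ \mathsf{let}\,y=(\mathsf{let}\,x=M\,\mathsf{in}\,N)\,\mathsf{in}\,P\equiv\mathsf{let}\,x=M\,\mathsf{in}\,(\mathsf{let}\,y=N\,\mathsf{in}\,P)$; $\ \mathsf{let}\,x=M\,\mathsf{in}\,\mathsf{return}\,x\equiv M$; - $\mathsf{let}\,x=(\mathsf{op}\,V\,(y.M))\,\mathsf{in}\,N\equiv\mathsf{op}\,V\,(y.\,\mathsf{let}\,x=M\,\mathsf{in}\,N)$; $\ \mathsf{let}\,x=(\mathsf{delay}\,\tau\,M)\,\mathsf{in}\,N\equiv\mathsf{delay}\,\tau\,(\mathsf{let}\,x=M\,\mathsf{in}\,N)$; - $\mathsf{handle}\,(\mathsf{return}\,V)\,\mathsf{with}\,H\,\mathsf{to}\,x\,\mathsf{in}\,N\equiv N[V/x]$; - $\mathsf{handle}\,(\mathsf{op}\,V\,(y.M))\,\mathsf{with}\,H\,\mathsf{to}\,x\,\mathsf{in}\,N\equiv M_{\mathsf{op}}[V/x,\ \mathsf{box}_{\tau_{\mathsf{op}}}(\mathsf{fun}\,(y:B_{\mathsf{op}})\mapsto\mathsf{handle}\,M\,\mathsf{with}\,H\,\mathsf{to}\,x\,\mathsf{in}\,N)/k]$; - $\mathsf{handle}\,(\mathsf{delay}\,\tau\,M)\,\mathsf{with}\,H\,\mathsf{to}\,x\,\mathsf{in}\,N\equiv\mathsf{delay}\,\tau\,(\mathsf{handle}\,M\,\mathsf{with}\,H\,\mathsf{to}\,x\,\mathsf{in}\,N)$; - $\mathsf{unbox}_\tau\,(\mathsf{box}_\tau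 V)\,\mathsf{as}\,x\,\mathsf{in}\,N\equiv N[V/x]$; $\ \mathsf{unbox}_\tau\,V\,\mathsf{as}\,x\,\mathsf{in}\,N[\mathsf{box}_\tau x/y]\equiv N[V/y]$. **Abstract models.** A model consists of a category $\mathbb C$ with finite products $(\mathbb 1,\times)$, exponentials $A\Rightarrow B$ (with $\mathsf{curry}$, $\mathsf{uncurry}$, and evaluation $\mathsf{ev}=\mathsf{uncurry}(\mathrm{id})$), and set-indexed products, an object $[\![b]\!]$ for each $b$, morphisms $[\![f]\!]:[\![A_1]\!]\times\dots\times[\![A_n]\!]\to[\![B]\!]$ for each constant, and the following. Here $\alpha:(A\times B)\times C\cong A\times(B\times C)$; equal grades such as $0+\tau=\tau$ are identified; indices of natural transformations may be omitted. (1) A functor $[-]:(\mathbb N,\le)\to[\mathbb C,\mathbb C]$ with natural isomorphisms $\varepsilon_A:[0]A\cong A$ and $\delta_{A,\tau_1,\tau_2}:[\tau_1+\tau_2]A\cong[\tau_1]([\tau_2]A)$ such that $\varepsilon_{[\tau]A}\circ\delta_{A,0,\tau}=\mathrm{id}$, $[\tau](\varepsilon_A)\circ\delta_{A,\tau,0}=\mathrm{id}$, $\delta_{[\tau_3]A,\tau_1,\tau_2}\circ\delta_{A,\tau_1+\tau_2,\tau_3}=[\tau_1](\delta_{A,\tau_2,\tau_3})\circ\delta_{A,\tau_1,\tau_2+\tau_3}$, and for $\tau_i\le\tau_i'$: $[\tau_1']([\tau_2\le\tau_2']_A)\circ[\tau_1\le\tau_1']_{[\tau_2]A}\circ\delta_{A,\tau_1,\tau_2}=\delta_{A,\tau_1',\tau_2'}\circ[\tau_1+\tau_2\le\tau_1'+\tau_2']_A$.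 (2) A functor $\langle-\rangle:(\mathbb N,\le)^{\mathrm{op}}\to[\mathbb C,\mathbb C]$ with natural isomorphisms $\eta_A:A\cong\langle0\rangle A$ and $\mu_{A,\tau_1,\tau_2}:\langle\tau_1\rangle(\langle\tau_2\rangle A)\cong\langle\tau_1+\tau_2\rangle A$ such that $\mu_{A,0,\tau}\circ\eta_{\langle\tau\rangle A}=\mathrm{id}$, $\mu_{A,\tau,0}\circ\langle\tau\rangle(\eta_A)=\mathrm{id}$, $\mu_{A,\tau_1+\tau_2,\tau_3}\circ\mu_{\langle\tau_3\rangle A,\tau_1,\tau_2}=\mu_{A,\tau_1,\tau_2+\tau_3}\circ\langle\tau_1\rangle(\mu_{A,\tau_2,\tau_3})$, and for $\tau_i\le\tau_i'$: $\mu_{A,\tau_1,\tau_2}\circ\langle\tau_1\rangle(\langle\tau_2\le\tau_2'\rangle_A)\circ\langle\tau_1\le\tau_1'\rangle_{\langle\tau_2'\rangle A}=\langle\tau_1+\tau_2\le\tau_1'+\tau_2'\rangle_A\circ\mu_{A,\tau_1',\tau_2'}$. (3) For each $\tau$ an adjunction $\langle\tau\rangle\dashv[\tau]$ with unit $\eta^{\dashv}_{A,\tau}:A\to[\tau](\langle\tau\rangle A)$ and counit $\varepsilon^{\dashv}_{A,\tau}:\langle\tau\rangle([\tau]A)\to A$, such that $[\tau](\langle0\le\tau\rangle_A)\circ\eta^{\dashv}_{A,\tau}\circ\eta_A^{-1}\circ\varepsilon_{\langle0\rangle A}=[0\le\tau]_{\langle0\rangle A}$; $\langle0\rangle([0\le\tau]_A)\circ\eta_{[0]A}\circ\varepsilon_A^{-1}\circ\varepsilon^{\dashv}_{A,\tau}=\langle0\le\tau\rangle_{[\tau]A}$;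 $[\tau_1]([\tau_2](\mu_{A,\tau_2,\tau_1}))\circ[\tau_1](\eta^{\dashv}_{\langle\tau_1\rangle A,\tau_2})\circ\eta^{\dashv}_{A,\tau_1}=\delta_{\langle\tau_1+\tau_2\rangle A,\tau_1,\tau_2}\circ\eta^{\dashv}_{A,\tau_1+\tau_2}$; $\varepsilon^{\dashv}_{A,\tau_1}\circ\langle\tau_1\rangle(\varepsilon^{\dashv}_{[\tau_1]A,\tau_2})\circ\langle\tau_1\rangle(\langle\tau_2\rangle(\delta_{A,\tau_2,\tau_1}))=\varepsilon^{\dashv}_{A,\tau_1+\tau_2}\circ\mu_{[\tau_1+\tau_2]A,\tau_1,\tau_2}$. Let $\mathsf m_{A,B,\tau}:[\tau]A\times[\tau]B\to[\tau](A\times B)$ be the canonical isomorphism (the right adjoint $[\tau]$ preserves products), and $\varepsilon^{\langle\rangle}_{A,\tau}=\eta_A^{-1}\circ\langle0\le\tau\rangle_A:\langle\tau\rangle A\to A$. (4) A $[-]$-strong graded monad: a functor $T:\mathbb N\to[\mathbb C,\mathbb C]$ ($\mathbb N$ discrete) with natural transformations $\eta^T_A:A\to T\,0\,A$, $\mu^T_{A,\tau_1,\tau_2}:T\,\tau_1(T\,\tau_2\,A)\to T(\tau_1+\tau_2)A$, $\mathsf{str}^T_{A,B,\tau}:[\tau]A\times T\,\tau\,B\to T\,\tau\,(A\times B)$ satisfying $\mu^T_{A,0,\tau}\circ\eta^T_{T\tau A}=\mathrm{id}$, $\mu^T_{A,\tau,0}\circ T\,\tau(\eta^T_A)=\mathrm{id}$,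 $\mu^T_{A,\tau_1+\tau_2,\tau_3}\circ\mu^T_{T\tau_3A,\tau_1,\tau_2}=\mu^T_{A,\tau_1,\tau_2+\tau_3}\circ T\,\tau_1(\mu^T_{A,\tau_2,\tau_3})$; and $\mathsf{str}^T_{A,B,0}\circ(\varepsilon_A^{-1}\times\eta^T_B)=\eta^T_{A\times B}$, $T\,\tau(\mathsf{snd})\circ\mathsf{str}^T_{A,B,\tau}=\mathsf{snd}$, $\mu^T_{A\times B,\tau_1,\tau_2}\circ T\,\tau_1(\mathsf{str}^T_{A,B,\tau_2})\circ\mathsf{str}^T_{[\tau_2]A,T\tau_2B,\tau_1}=\mathsf{str}^T_{A,B,\tau_1+\tau_2}\circ(\delta^{-1}_{A,\tau_1,\tau_2}\times\mu^T_{B,\tau_1,\tau_2})$, $T\,\tau(\alpha)\circ\mathsf{str}^T_{A\times B,C,\tau}\circ(\mathsf m_{A,B,\tau}\times\mathrm{id})\circ\alpha^{-1}=\mathsf{str}^T_{A,B\times C,\tau}\circ(\mathrm{id}\times\mathsf{str}^T_{B,C,\tau})$. (5) Algebraic operations, natural in $A$: $\mathsf{op}^T_{A,\tau}:[\![A_{\mathsf{op}}]\!]\times[\tau_{\mathsf{op}}]([\![B_{\mathsf{op}}]\!]\Rightarrow T\,\tau\,A)\to T(\tau_{\mathsf{op}}+\tau)A$ for each $\mathsf{op}\in\mathcal O$, and $\mathsf{delay}^T_{A,\tau'}\tau:[\tau](T\,\tau'A)\to T(\tau+\tau')A$ for each $\tau$. Write $\mathsf{push}:C\times(B\Rightarrow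 D)\to B\Rightarrow(C\times D)$ for the canonical map and $\sigma:C\times(A\times D)\cong A\times(C\times D)$. Laws (writing $A_{\mathsf{op}},B_{\mathsf{op}}$ for their interpretations): $\mu^T_{A,\tau_{\mathsf{op}}+\tau,\tau'}\circ\mathsf{op}^T_{T\tau'A,\tau}=\mathsf{op}^T_{A,\tau+\tau'}\circ(\mathrm{id}\times[\tau_{\mathsf{op}}](B_{\mathsf{op}}\Rightarrow\mu^T_{A,\tau,\tau'}))$; $\mu^T_{A,\tau+\tau',\tau''}\circ\mathsf{delay}^T_{T\tau''A,\tau'}\tau=\mathsf{delay}^T_{A,\tau'+\tau''}\tau\circ[\tau](\mu^T_{A,\tau',\tau''})$; $\mathsf{str}^T_{A,B,\tau_{\mathsf{op}}+\tau}\circ(\mathrm{id}\times\mathsf{op}^T_{B,\tau})=\mathsf{op}^T_{A\times B,\tau}\circ(\mathrm{id}\times([\tau_{\mathsf{op}}]((B_{\mathsf{op}}\Rightarrow\mathsf{str}^T_{A,B,\tau})\circ\mathsf{push})\circ\mathsf m\circ(\delta_{A,\tau_{\mathsf{op}},\tau}\times\mathrm{id})))\circ\sigma$; $\mathsf{str}^T_{A,B,\tau+\tau'}\circ(\mathrm{id}\times\mathsf{delay}^T_{B,\tau'}\tau)=\mathsf{delay}^T_{A\times B,\tau'}\tau\circ[\tau](\mathsf{str}^T_{A,B,\tau'})\circ\mathsf m\circ(\delta_{A,\tau,\tau'}\times\mathrm{id})$. (6) Handling morphisms $\chi_{A,\tau,\tau'}:\mathcal H_A\to(T\,\tau(T\,\tau'A)\Rightarrow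 T(\tau+\tau')A)$, where $\mathcal H_A=\prod_{\mathsf{op}\in\mathcal O}\prod_{\tau''\in\mathbb N}\big(([\![A_{\mathsf{op}}]\!]\times[\tau_{\mathsf{op}}]([\![B_{\mathsf{op}}]\!]\Rightarrow T\,\tau''A))\Rightarrow T(\tau_{\mathsf{op}}+\tau'')A\big)$, satisfying (with $\mathcal H=\mathcal H_A$) $\mathsf{uncurry}(\chi_{A,0,\tau})\circ(\mathrm{id}\times\eta^T_{T\tau A})=\mathsf{snd}$; $\mathsf{uncurry}(\chi_{A,\tau+\tau',\tau''})\circ(\mathrm{id}\times\mathsf{delay}^T_{T\tau''A,\tau'}\tau)=\mathsf{delay}^T_{A,\tau'+\tau''}\tau\circ[\tau]\big(\mathsf{uncurry}(\chi_{A,\tau',\tau''})\circ(\varepsilon^{\langle\rangle}_{\mathcal H,\tau}\times\mathrm{id})\big)\circ\mathsf m\circ(\eta^{\dashv}_{\mathcal H,\tau}\times\mathrm{id})$; $\mathsf{uncurry}(\chi_{A,\tau_{\mathsf{op}}+\tau,\tau'})\circ(\mathrm{id}\times\mathsf{op}^T_{T\tau'A,\tau})=\mathsf{ev}\circ\langle\pi_{\tau+\tau'}\circ\pi_{\mathsf{op}}\circ\mathsf{fst},\ (\mathrm{id}\times\kappa)\circ\sigma\rangle$, where $\kappa=[\tau_{\mathsf{op}}]\big((B_{\mathsf{op}}\Rightarrow\mathsf{uncurry}(\chi_{A,\tau,\tau'}))\circ\mathsf{push}\circ(\varepsilon^{\langle\rangle}_{\mathcal H,\tau_{\mathsf{op}}}\times\mathrm{id})\big)\circ\mathsf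 m\circ(\eta^{\dashv}_{\mathcal H,\tau_{\mathsf{op}}}\times\mathrm{id})$. **Interpretation.** Types: $[\![\mathsf{unit}]\!]=\mathbb 1$, $[\![X\times Y]\!]=[\![X]\!]\times[\![Y]\!]$, $[\![X\to Y\,!\,\tau]\!]=[\![X]\!]\Rightarrow T\,\tau[\![Y]\!]$, $[\![[\tau]X]\!]=[\tau][\![X]\!]$. Contexts are functors $\mathbb C\to\mathbb C$: $[\![\cdot]\!]A=A$, $[\![\Gamma,x{:}X]\!]A=[\![\Gamma]\!]A\times[\![X]\!]$, $[\![\Gamma,\langle\tau\rangle]\!]A=\langle\tau\rangle([\![\Gamma]\!]A)$; hence canonically $\iota:[\![\Gamma,\Gamma']\!]A\cong[\![\Gamma']\!]([\![\Gamma]\!]A)$. $\mathsf e_{A,\Gamma}:[\![\Gamma]\!]A\to\langle\mathsf{time}\,\Gamma\rangle A$ is: $\mathsf e_{A,\cdot}=\eta_A$, $\mathsf e_{A,(\Gamma,x:X)}=\mathsf e_{A,\Gamma}\circ\mathsf{fst}$, $\mathsf e_{A,(\Gamma,\langle\tau\rangle)}=\mu_{A,\tau,\mathsf{time}\,\Gamma}\circ\langle\tau\rangle(\mathsf e_{A,\Gamma})$. For $\tau\le\mathsf{time}\,\Gamma$, $\eta^{\mathrm{PRA}}_{\Gamma,A,\tau}:[\![\Gamma]\!]A\to\langle\tau\rangle([\![\Gamma-\tau]\!]A)$ is: $\eta$ if $\tau=0$; and for $\tau\ge1$: $\eta^{\mathrm{PRA}}_{\Gamma,A,\tau}\circ\mathsf{fst}$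 for $(\Gamma,x{:}X)$; for $(\Gamma,\langle\tau'\rangle)$ it is $\mu^{-1}_{[\![\Gamma]\!]A,\tau,\tau'\dot-\tau}$ if $\tau\le\tau'$, and $\mu_{\tau',\tau\dot-\tau'}\circ\langle\tau'\rangle(\eta^{\mathrm{PRA}}_{\Gamma,A,\tau\dot-\tau'})$ otherwise. Values $\Gamma\vdash V:X$ are interpreted as $[\![V]\!]:[\![\Gamma]\!]\mathbb 1\to[\![X]\!]$ and computations $\Gamma\vdash M:X\,!\,\tau$ as $[\![M]\!]:[\![\Gamma]\!]\mathbb 1\to T\,\tau[\![X]\!]$, by recursion on typing derivations: $[\![x]\!]=\mathsf{snd}\circ\varepsilon^{\langle\rangle}\circ\mathsf e_{-,\Gamma'}\circ\iota$ (for $\Gamma,x{:}X,\Gamma'\vdash x:X$); $[\![f(V_1,\dots,V_n)]\!]=[\![f]\!]\circ\langle[\![V_1]\!],\dots,[\![V_n]\!]\rangle$; $[\![()]\!]={!}$; $[\![(V,W)]\!]=\langle[\![V]\!],[\![W]\!]\rangle$; $[\![\mathsf{fun}\,(x:X)\mapsto M]\!]=\mathsf{curry}([\![M]\!])$; $[\![\mathsf{box}_\tau V]\!]=[\tau]([\![V]\!])\circ\eta^{\dashv}$; $[\![\mathsf{return}\,V]\!]=\eta^T\circ[\![V]\!]$; $[\![\mathsf{let}\,x=M\,\mathsf{in}\,N]\!]=\mu^T\circ T\,\tau([\![N]\!])\circ\mathsf{str}^T\circ\langle\eta^{\dashv},[\![M]\!]\rangle$; $[\![V\,W]\!]=\mathsf{ev}\circ\langle[\![V]\!],[\![W]\!]\rangle$;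 $[\![\mathsf{match}\,V\,\mathsf{with}\,\{(x,y)\mapsto N\}]\!]=[\![N]\!]\circ\alpha^{-1}\circ\langle\mathrm{id},[\![V]\!]\rangle$; $[\![\mathsf{op}\,V\,(x.M)]\!]=\mathsf{op}^T\circ(\mathrm{id}\times[\tau_{\mathsf{op}}](\mathsf{curry}[\![M]\!]))\circ\langle[\![V]\!],\eta^{\dashv}\rangle$; $[\![\mathsf{delay}\,\tau\,M]\!]=\mathsf{delay}^T\tau\circ[\tau]([\![M]\!])\circ\eta^{\dashv}$; $[\![\mathsf{handle}\,M\,\mathsf{with}\,H\,\mathsf{to}\,x\,\mathsf{in}\,N]\!]=\mathsf{uncurry}(\chi_{[\![Y]\!],\tau,\tau'})\circ([\![H]\!]\times\mathrm{id})\circ(\mathrm{id}\times T\,\tau([\![N]\!]))\circ(\mathrm{id}\times\mathsf{str}^T)\circ\langle\mathrm{id},\langle\eta^{\dashv},[\![M]\!]\rangle\rangle$, where $[\![H]\!]:[\![\Gamma]\!]\mathbb 1\to\mathcal H_{[\![Y]\!]}$ has $(\mathsf{op},\tau'')$-component $\mathsf{curry}([\![M_{\mathsf{op}}]\!]_{\tau''}\circ\alpha^{-1})$, with $[\![M_{\mathsf{op}}]\!]_{\tau''}$ the interpretation of the typing of $M_{\mathsf{op}}$ at $\tau''$; $[\![\mathsf{unbox}_\tau\,V\,\mathsf{as}\,x\,\mathsf{in}\,N]\!]=[\![N]\!]\circ(\mathrm{id}\times\varepsilon^{\dashv})\circ(\mathrm{id}\times\langle\tau\rangle([\![V]\!]))\circ\langle\mathrm{id},\eta^{\mathrm{PRA}}_{\Gamma,\mathbb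 1,\tau}\rangle$. *)

(* Defs.v *)
(* Grades are [nat] with the boolean order of ssrnat, whose proofs are unique. *)
From mathcomp Require Import all_boot.

Set Implicit Arguments.
Unset Strict Implicit.
Unset Printing Implicit Defensive.

Declare Scope cat_scope.
Delimit Scope cat_scope with cat.
Local Open Scope cat_scope.

(** * Syntax *)

Inductive gty (base : Type) : Type :=
| GBase (b : base)
| GUnit
| GProd (A B : gty base)
| GBox (t : nat) (A : gty base).
Arguments GUnit {base}.

Record signature : Type := Signature {
  base_ty : Type;
  const_sym : Type;
  arity : const_sym -> nat;
  const_dom : forall f : const_sym, 'I_(arity f) -> gty base_ty;
  const_cod : const_sym -> gty base_ty;
  op_sym : Type;
  op_in : op_sym -> gty base_ty;
  op_out : op_sym -> gty base_ty;
  op_time : op_sym -> nat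
}.

(* The grammar of value types contains every ground type, and a product (or a
   [t]-modality) of ground types is the same type whichever production built
   it; so the ground types are the image of [ground] below rather than a
   separate constructor.  [VArr X Y t] is X -> Y ! t. *)
Inductive vty (base : Type) : Type :=
| VBase (b : base)
| VUnit
| VProd (X Y : vty base)
| VArr (X Y : vty base) (t : nat)
| VBox (t : nat) (X : vty base).
Arguments VUnit {base}.

Fixpoint ground (base : Type) (A : gty base) : vty base :=
  match A with
  | GBase b => VBase b
  | GUnit => VUnit
  | GProd A B => VProd (ground A) (ground B)
  | GBox t A => VBox t (ground A)
  end.

Coercion ground : gty >-> vty.

(* Terms up to alpha-equivalence: de Bruijn indices, which count the variables
   of a context from the right and skip its time modalities.  In [Match], and
   in handler clauses (x. k. M_op), the second bound variable has index 0 and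
   the first has index 1. *)
Inductive value (S : signature) : Type :=
| Var (n : nat)
| Const (f : const_sym S) (Vs : 'I_(arity f) -> value S)
| Unit
| Pair (V W : value S)
| Fun (X : vty (base_ty S)) (M : computation S)
| Box (t : nat) (V : value S)
with computation (S : signature) : Type :=
| Return (V : value S)
| Let (M N : computation S)
| App (V W : value S)
| Match (V : value S) (N : computation S)
| Op (o : op_sym S) (V : value S) (M : computation S)
| Delay (t : nat) (M : computation S)
| Handle (M : computation S) (H : op_sym S -> computation S) (N : computation S)
| Unbox (t : nat) (V : value S) (N : computation S).

Arguments Var {S} n.
Arguments Const {S} f Vs.
Arguments Unit {S}.

Definition scons (T : Type) (x : T) (s : nat -> T) (n : nat) : T :=
  if n is n'.+1 then s n' else x.
Notation "x .: s" := (scons x s) (at level 55, right associativity) : cat_scope.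

Definition up_ren (r : nat -> nat) : nat -> nat := 0 .: (fun n => (r n).+1).

Fixpoint ren_val (S : signature) (r : nat -> nat) (V : value S) : value S :=
  match V with
  | Var n => Var (r n)
  | Const f Vs => Const f (fun i => ren_val r (Vs i))
  | Unit => Unit
  | Pair V W => Pair (ren_val r V) (ren_val r W)
  | Fun X M => Fun X (ren_comp (up_ren r) M)
  | Box t V => Box t (ren_val r V)
  end
with ren_comp (S : signature) (r : nat -> nat) (M : computation S) :
    computation S :=
  match M with
  | Return V => Return (ren_val r V)
  | Let M N => Let (ren_comp r M) (ren_comp (up_ren r) N)
  | App V W => App (ren_val r V) (ren_val r W)
  | Match V N => Match (ren_val r V) (ren_comp (up_ren (up_ren r)) N)
  | Op o V M => Op o (ren_val r V) (ren_comp (up_ren r) M)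
  | Delay t M => Delay t (ren_comp r M)
  | Handle M H N =>
      Handle (ren_comp r M) (fun o => ren_comp (up_ren (up_ren r)) (H o))
             (ren_comp (up_ren r) N)
  | Unbox t V N => Unbox t (ren_val r V) (ren_comp (up_ren r) N)
  end.

Definition weaken (S : signature) (k : nat) : value S -> value S :=
  ren_val (addn k).

Definition up_sub (S : signature) (s : nat -> value S) : nat -> value S :=
  Var 0 .: (fun n => weaken 1 (s n)).

Fixpoint sub_val (S : signature) (s : nat -> value S) (V : value S) : value S :=
  match V with
  | Var n => s n
  | Const f Vs => Const f (fun i => sub_val s (Vs i))
  | Unit => Unit
  | Pair V W => Pair (sub_val s V) (sub_val s W)
  | Fun X M => Fun X (sub_comp (up_sub s) M)
  | Box t V => Box t (sub_val s V)
  end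
with sub_comp (S : signature) (s : nat -> value S) (M : computation S) :
    computation S :=
  match M with
  | Return V => Return (sub_val s V)
  | Let M N => Let (sub_comp s M) (sub_comp (up_sub s) N)
  | App V W => App (sub_val s V) (sub_val s W)
  | Match V N => Match (sub_val s V) (sub_comp (up_sub (up_sub s)) N)
  | Op o V M => Op o (sub_val s V) (sub_comp (up_sub s) M)
  | Delay t M => Delay t (sub_comp s M)
  | Handle M H N =>
      Handle (sub_comp s M) (fun o => sub_comp (up_sub (up_sub s)) (H o))
             (sub_comp (up_sub s) N)
  | Unbox t V N => Unbox t (sub_val s V) (sub_comp (up_sub s) N)
  end.

(* M[V/x] for the most recently bound x *)
Definition inst (S : signature) (M : computation S) (V : value S) :
    computation S :=
  sub_comp (V .: @Var S) M.

(* The substitution [W/x] for the x that is followed by n further variables. *)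
Definition sub_at (S : signature) (n : nat) (W : value S) : nat -> value S :=
  iter n (@up_sub S) (W .: @Var S).

(* Weakening of a term under one binder, resp. of a handler clause, by one
   variable inserted just outside its own bound variables. *)
Definition lift1 (S : signature) : computation S -> computation S :=
  ren_comp (up_ren succn).
Definition lift2 (S : signature) : computation S -> computation S :=
  ren_comp (up_ren (up_ren succn)).

(** * Contexts and typing *)

Inductive ctx (base : Type) : Type :=
| Empty
| Ext (G : ctx base) (X : vty base)
| Clock (G : ctx base) (t : nat).
Arguments Empty {base}.

Notation "G ▹ X" := (Ext G X) (at level 45, left associativity) : cat_scope.
Notation "G ⊳⟨ t ⟩" := (Clock G t)
  (at level 45, left associativity, format "G  ⊳⟨ t ⟩") : cat_scope.

Fixpoint ctx_cat (base : Type) (G G' : ctx base) : ctx base :=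
  match G' with
  | Empty => G
  | G' ▹ X => ctx_cat G G' ▹ X
  | G' ⊳⟨ t ⟩ => ctx_cat G G' ⊳⟨ t ⟩
  end.

Fixpoint nvars (base : Type) (G : ctx base) : nat :=
  match G with
  | Empty => 0
  | G ▹ _ => (nvars G).+1
  | G ⊳⟨ _ ⟩ => nvars G
  end.

Fixpoint ctime (base : Type) (G : ctx base) : nat :=
  match G with
  | Empty => 0
  | G ▹ _ => ctime G
  | G ⊳⟨ t ⟩ => ctime G + t
  end.

Fixpoint ctx_minus (base : Type) (G : ctx base) (t : nat) {struct G} : ctx base :=
  match t with
  | 0 => G
  | _.+1 =>
      match G with
      | Empty => Empty
      | G' ▹ _ => ctx_minus G' t
      | G' ⊳⟨ t' ⟩ => if t <= t' then G' ⊳⟨ t' - t ⟩ else ctx_minus G' (t - t')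
      end
  end.

(* the number of variables that G - t discards from the right of G *)
Definition ndropped (base : Type) (G : ctx base) (t : nat) : nat :=
  nvars G - nvars (ctx_minus G t).

Reserved Notation "G ⊢v V : X" (at level 70, V at level 69, X at level 69).
Reserved Notation "G ⊢c M : X ! t"
  (at level 70, M at level 69, X at level 44, t at level 44).

(* In the rule for unbox, V is typed in G - t but occurs in the term in the
   scope of all the variables of G; the variables of G - t are the oldest ones
   of G, so its indices are raised by the number of discarded variables. *)
Inductive vtyped (S : signature) :
    ctx (base_ty S) -> value S -> vty (base_ty S) -> Type :=
| TVar G X G' :
    ctx_cat (G ▹ X) G' ⊢v Var (nvars G') : X
| TConst G f Vs :
    (forall i, G ⊢v Vs i : const_dom i) ->
    G ⊢v Const f Vs : const_cod f
| TUnit G :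
    G ⊢v Unit : VUnit
| TPair G V W X Y :
    G ⊢v V : X ->
    G ⊢v W : Y ->
    G ⊢v Pair V W : VProd X Y
| TFun G X M Y t :
    G ▹ X ⊢c M : Y ! t ->
    G ⊢v Fun X M : VArr X Y t
| TBox G t V X :
    G ⊳⟨ t ⟩ ⊢v V : X ->
    G ⊢v Box t V : VBox t X
with ctyped (S : signature) :
    ctx (base_ty S) -> computation S -> vty (base_ty S) -> nat -> Type :=
| TReturn G V X :
    G ⊢v V : X ->
    G ⊢c Return V : X ! 0
| TLet G M N X Y t t' :
    G ⊢c M : X ! t ->
    G ⊳⟨ t ⟩ ▹ X ⊢c N : Y ! t' ->
    G ⊢c Let M N : Y ! (t + t')
| TApp G V W X Y t :
    G ⊢v V : VArr X Y t ->
    G ⊢v W : X ->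
    G ⊢c App V W : Y ! t
| TMatch G V N X Y Z t :
    G ⊢v V : VProd X Y ->
    G ▹ X ▹ Y ⊢c N : Z ! t ->
    G ⊢c Match V N : Z ! t
| TOp G o V M X t :
    G ⊢v V : op_in o ->
    G ⊳⟨ op_time o ⟩ ▹ op_out o ⊢c M : X ! t ->
    G ⊢c Op o V M : X ! (op_time o + t)
| TDelay G t M X t' :
    G ⊳⟨ t ⟩ ⊢c M : X ! t' ->
    G ⊢c Delay t M : X ! (t + t')
| THandle G M H N X Y t t' :
    G ⊢c M : X ! t ->
    G ⊳⟨ t ⟩ ▹ X ⊢c N : Y ! t' ->
    (forall o t'',
       G ▹ op_in o ▹ VBox (op_time o) (VArr (op_out o) Y t'')
       ⊢c H o : Y ! (op_time o + t'')) ->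
    G ⊢c Handle M H N : Y ! (t + t')
| TUnbox G t V N X Y t' :
    t <= ctime G ->
    ctx_minus G t ⊢v V : VBox t X ->
    G ▹ X ⊢c N : Y ! t' ->
    G ⊢c Unbox t (weaken (ndropped G t) V) N : Y ! t'
where "G ⊢v V : X" := (vtyped G V X) : cat_scope
and "G ⊢c M : X ! t" := (ctyped G M X t) : cat_scope.

Definition htyped (S : signature) (G : ctx (base_ty S))
    (H : op_sym S -> computation S) (Y : vty (base_ty S)) : Type :=
  forall o t'',
    G ▹ op_in o ▹ VBox (op_time o) (VArr (op_out o) Y t'')
    ⊢c H o : Y ! (op_time o + t'').

(** * Equational theory *)

Reserved Notation "G ⊢v V ≡ W : X"
  (at level 70, V at level 69, W at level 69, X at level 69).
Reserved Notation "G ⊢c M ≡ N : X ! t"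
  (at level 70, M at level 69, N at level 69, X at level 44, t at level 44).

(* Each axiom carries the typings of its metavariables, which make both of its
   sides well typed. *)
Inductive veq (S : signature) :
    ctx (base_ty S) -> value S -> value S -> vty (base_ty S) -> Prop :=
| VRefl G V X :
    G ⊢v V : X ->
    G ⊢v V ≡ V : X
| VSym G V W X :
    G ⊢v V ≡ W : X ->
    G ⊢v W ≡ V : X
| VTrans G V W U X :
    G ⊢v V ≡ W : X ->
    G ⊢v W ≡ U : X ->
    G ⊢v V ≡ U : X
| VConst G f Vs Ws :
    (forall i, G ⊢v Vs i ≡ Ws i : const_dom i) ->
    G ⊢v Const f Vs ≡ Const f Ws : const_cod f
| VPair G V V' W W' X Y :
    G ⊢v V ≡ V' : X ->
    G ⊢v W ≡ W' : Y ->
    G ⊢v Pair V W ≡ Pair V' W' : VProd X Y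
| VFun G X M N Y t :
    G ▹ X ⊢c M ≡ N : Y ! t ->
    G ⊢v Fun X M ≡ Fun X N : VArr X Y t
| VBoxC G t V W X :
    G ⊳⟨ t ⟩ ⊢v V ≡ W : X ->
    G ⊢v Box t V ≡ Box t W : VBox t X
| VSubst G X G' V W U Y :
    ctx_cat (G ▹ X) G' ⊢v V ≡ W : Y ->
    G ⊢v U : X ->
    ctx_cat G G' ⊢v sub_val (sub_at (nvars G') U) V
                  ≡ sub_val (sub_at (nvars G') U) W : Y
| VUnitEta G V :
    G ⊢v V : VUnit ->
    G ⊢v Unit ≡ V : VUnit
| VFunEta G V X Y t :
    G ⊢v V : VArr X Y t ->
    G ⊢v Fun X (App (weaken 1 V) (Var 0)) ≡ V : VArr X Y t
with ceq (S : signature) :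
    ctx (base_ty S) -> computation S -> computation S ->
    vty (base_ty S) -> nat -> Prop :=
| CRefl G M X t :
    G ⊢c M : X ! t ->
    G ⊢c M ≡ M : X ! t
| CSym G M N X t :
    G ⊢c M ≡ N : X ! t ->
    G ⊢c N ≡ M : X ! t
| CTrans G M N P X t :
    G ⊢c M ≡ N : X ! t ->
    G ⊢c N ≡ P : X ! t ->
    G ⊢c M ≡ P : X ! t
| CReturn G V W X :
    G ⊢v V ≡ W : X ->
    G ⊢c Return V ≡ Return W : X ! 0
| CLet G M M' N N' X Y t t' :
    G ⊢c M ≡ M' : X ! t ->
    G ⊳⟨ t ⟩ ▹ X ⊢c N ≡ N' : Y ! t' ->
    G ⊢c Let M N ≡ Let M' N' : Y ! (t + t')
| CApp G V V' W W' X Y t :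
    G ⊢v V ≡ V' : VArr X Y t ->
    G ⊢v W ≡ W' : X ->
    G ⊢c App V W ≡ App V' W' : Y ! t
| CMatch G V V' N N' X Y Z t :
    G ⊢v V ≡ V' : VProd X Y ->
    G ▹ X ▹ Y ⊢c N ≡ N' : Z ! t ->
    G ⊢c Match V N ≡ Match V' N' : Z ! t
| COp G o V V' M M' X t :
    G ⊢v V ≡ V' : op_in o ->
    G ⊳⟨ op_time o ⟩ ▹ op_out o ⊢c M ≡ M' : X ! t ->
    G ⊢c Op o V M ≡ Op o V' M' : X ! (op_time o + t)
| CDelay G t M M' X t' :
    G ⊳⟨ t ⟩ ⊢c M ≡ M' : X ! t' ->
    G ⊢c Delay t M ≡ Delay t M' : X ! (t + t')
| CHandle G M M' H H' N N' X Y t t' :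
    G ⊢c M ≡ M' : X ! t ->
    G ⊳⟨ t ⟩ ▹ X ⊢c N ≡ N' : Y ! t' ->
    (forall o t'',
       G ▹ op_in o ▹ VBox (op_time o) (VArr (op_out o) Y t'')
       ⊢c H o ≡ H' o : Y ! (op_time o + t'')) ->
    G ⊢c Handle M H N ≡ Handle M' H' N' : Y ! (t + t')
| CUnbox G t V W N N' X Y t' :
    t <= ctime G ->
    ctx_minus G t ⊢v V ≡ W : VBox t X ->
    G ▹ X ⊢c N ≡ N' : Y ! t' ->
    G ⊢c Unbox t (weaken (ndropped G t) V) N
       ≡ Unbox t (weaken (ndropped G t) W) N' : Y ! t'
| CSubst G X G' M N U Y t :
    ctx_cat (G ▹ X) G' ⊢c M ≡ N : Y ! t ->
    G ⊢v U : X ->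
    ctx_cat G G' ⊢c sub_comp (sub_at (nvars G') U) M
                  ≡ sub_comp (sub_at (nvars G') U) N : Y ! t
| CFunBeta G X M V Y t :
    G ▹ X ⊢c M : Y ! t ->
    G ⊢v V : X ->
    G ⊢c App (Fun X M) V ≡ inst M V : Y ! t
| CMatchBeta G V W N X Y Z t :
    G ⊢v V : X ->
    G ⊢v W : Y ->
    G ▹ X ▹ Y ⊢c N : Z ! t ->
    G ⊢c Match (Pair V W) N ≡ sub_comp (W .: V .: @Var S) N : Z ! t
| CMatchEta G V N X Y Z t :
    G ⊢v V : VProd X Y ->
    G ▹ VProd X Y ⊢c N : Z ! t ->
    G ⊢c Match V (sub_comp (Pair (Var 1) (Var 0) .: (fun n => Var n.+2)) N)
       ≡ inst N V : Z ! t
| CLetReturn G V N X Y t :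
    G ⊢v V : X ->
    G ⊳⟨ 0 ⟩ ▹ X ⊢c N : Y ! t ->
    G ⊢c Let (Return V) N ≡ inst N V : Y ! t
| CLetLet G M N P X Y Z t t' t'' :
    G ⊢c M : X ! t ->
    G ⊳⟨ t ⟩ ▹ X ⊢c N : Y ! t' ->
    G ⊳⟨ t + t' ⟩ ▹ Y ⊢c P : Z ! t'' ->
    G ⊢c Let (Let M N) P ≡ Let M (Let N (lift1 P)) : Z ! (t + t' + t'')
| CLetEta G M X t :
    G ⊢c M : X ! t ->
    G ⊢c Let M (Return (Var 0)) ≡ M : X ! t
| CLetOp G o V M N X Y t t' :
    G ⊢v V : op_in o ->
    G ⊳⟨ op_time o ⟩ ▹ op_out o ⊢c M : X ! t ->
    G ⊳⟨ op_time o + t ⟩ ▹ X ⊢c N : Y ! t' ->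
    G ⊢c Let (Op o V M) N ≡ Op o V (Let M (lift1 N)) : Y ! (op_time o + t + t')
| CLetDelay G M N X Y t t' t'' :
    G ⊳⟨ t ⟩ ⊢c M : X ! t' ->
    G ⊳⟨ t + t' ⟩ ▹ X ⊢c N : Y ! t'' ->
    G ⊢c Let (Delay t M) N ≡ Delay t (Let M N) : Y ! (t + t' + t'')
| CHandleReturn G V H N X Y t :
    G ⊢v V : X ->
    htyped G H Y ->
    G ⊳⟨ 0 ⟩ ▹ X ⊢c N : Y ! t ->
    G ⊢c Handle (Return V) H N ≡ inst N V : Y ! t
| CHandleOp G o V M H N X Y t t' :
    G ⊢v V : op_in o ->
    G ⊳⟨ op_time o ⟩ ▹ op_out o ⊢c M : X ! t ->
    htyped G H Y ->
    G ⊳⟨ op_time o + t ⟩ ▹ X ⊢c N : Y ! t' ->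
    G ⊢c Handle (Op o V M) H N
       ≡ sub_comp
           (Box (op_time o)
              (Fun (op_out o) (Handle M (fun o' => lift2 (H o')) (lift1 N)))
            .: V .: @Var S) (H o) : Y ! (op_time o + t + t')
| CHandleDelay G M H N X Y t t' t'' :
    G ⊳⟨ t ⟩ ⊢c M : X ! t' ->
    htyped G H Y ->
    G ⊳⟨ t + t' ⟩ ▹ X ⊢c N : Y ! t'' ->
    G ⊢c Handle (Delay t M) H N ≡ Delay t (Handle M H N) : Y ! (t + t' + t'')
| CUnboxBeta G t V N X Y t' :
    t <= ctime G ->
    ctx_minus G t ⊳⟨ t ⟩ ⊢v V : X ->
    G ▹ X ⊢c N : Y ! t' ->
    G ⊢c Unbox t (weaken (ndropped G t) (Box t V)) N
       ≡ inst N (weaken (ndropped G t) V) : Y ! t'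
| CUnboxEta G t V N X Y t' :
    t <= ctime G ->
    ctx_minus G t ⊢v V : VBox t X ->
    G ▹ VBox t X ⊢c N : Y ! t' ->
    G ⊢c Unbox t (weaken (ndropped G t) V)
           (sub_comp (Box t (Var 0) .: (fun n => Var n.+1)) N)
       ≡ inst N (weaken (ndropped G t) V) : Y ! t'
where "G ⊢v V ≡ W : X" := (veq G V W X) : cat_scope
and "G ⊢c M ≡ N : X ! t" := (ceq G M N X t) : cat_scope.

(** * Categories *)

Record category : Type := Category {
  obj :> Type;
  hom : obj -> obj -> Type;
  idm : forall A, hom A A;
  comp : forall A B C, hom B C -> hom A B -> hom A C;
  comp_idl : forall A B (f : hom A B), comp (idm B) f = f;
  comp_idr : forall A B (f : hom A B), comp f (idm A) = f;
  comp_assoc : forall A B C D (h : hom C D) (g : hom B C) (f : hom A B),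
    comp (comp h g) f = comp h (comp g f)
}.
Arguments idm {c} A.

Notation "g ∘ f" := (comp g f) (at level 40, left associativity) : cat_scope.
Notation id_ := (idm _).

(* The identification of F m with F n for equal grades m and n: the identity,
   transported along the equality. *)
Definition gcast (C : category) (F : nat -> C) (m n : nat) (e : m = n) :
    hom (F m) (F n) :=
  match e in _ = k return hom (F m) (F k) with erefl => idm (F m) end.

Record endofunctor (C : category) : Type := Endofunctor {
  fobj :> C -> C;
  fmap : forall A B, hom A B -> hom (fobj A) (fobj B);
  fmap_id : forall A, fmap (idm A) = idm (fobj A);
  fmap_comp : forall A B D (g : hom B D) (f : hom A B),
    fmap (g ∘ f) = fmap g ∘ fmap f
}.

(* Finite products, set-indexed products and exponentials. *)
Record ccategory : Type := CCategory {
  cc_cat :> category;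

  one : cc_cat;
  bang : forall A, hom A one;
  bang_uniq : forall A (f : hom A one), f = bang A;

  prod : cc_cat -> cc_cat -> cc_cat;
  fst : forall A B, hom (prod A B) A;
  snd : forall A B, hom (prod A B) B;
  pair : forall D A B, hom D A -> hom D B -> hom D (prod A B);
  fst_pair : forall D A B (f : hom D A) (g : hom D B), @fst A B ∘ pair f g = f;
  snd_pair : forall D A B (f : hom D A) (g : hom D B), @snd A B ∘ pair f g = g;
  pair_uniq : forall D A B (h : hom D (prod A B)),
    h = pair (@fst A B ∘ h) (@snd A B ∘ h);

  iprod : forall I : Type, (I -> cc_cat) -> cc_cat;
  proj : forall (I : Type) (F : I -> cc_cat) (i : I), hom (iprod F) (F i);
  tuple : forall (I : Type) (F : I -> cc_cat) D,
    (forall i, hom D (F i)) -> hom D (iprod F);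
  proj_tuple : forall I (F : I -> cc_cat) D (f : forall i, hom D (F i)) i,
    proj F i ∘ tuple f = f i;
  tuple_uniq : forall I (F : I -> cc_cat) D (f : forall i, hom D (F i))
      (h : hom D (iprod F)),
    (forall i, proj F i ∘ h = f i) -> h = tuple f;

  exp : cc_cat -> cc_cat -> cc_cat;
  curry : forall D A B, hom (prod D A) B -> hom D (exp A B);
  uncurry : forall D A B, hom D (exp A B) -> hom (prod D A) B;
  curryK : forall D A B (f : hom (prod D A) B), uncurry (curry f) = f;
  uncurryK : forall D A B (g : hom D (exp A B)), curry (uncurry g) = g;
  curry_nat : forall D' D A B (f : hom (prod D A) B) (h : hom D' D),
    curry f ∘ h =
    curry (f ∘ pair (h ∘ @fst D' A) (@snd D' A))
}.
Arguments fst {c A B}.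
Arguments snd {c A B}.
Arguments bang {c A}.
Arguments proj {c I F} i.

Notation "A × B" := (prod A B) (at level 40, left associativity) : cat_scope.
Notation "A ⇒ B" := (exp A B) (at level 55, right associativity) : cat_scope.
Notation "⟨ f , g ⟩" := (pair f g) (at level 0, format "⟨ f ,  g ⟩") : cat_scope.

Definition pmap (C : ccategory) (A A' B B' : C) (f : hom A A') (g : hom B B') :
    hom (A × B) (A' × B') :=
  ⟨f ∘ fst, g ∘ snd⟩.
Notation "f ×m g" := (pmap f g) (at level 40, left associativity) : cat_scope.

Definition ev (C : ccategory) (A B : C) : hom ((A ⇒ B) × A) B :=
  uncurry (idm (A ⇒ B)).
Arguments ev {C A B}.

Definition expmap (C : ccategory) (A B B' : C) (f : hom B B') :
    hom (A ⇒ B) (A ⇒ B') :=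
  curry (f ∘ ev).
Arguments expmap {C} A {B B'} f.

Definition alpha (C : ccategory) (A B D : C) :
    hom ((A × B) × D) (A × (B × D)) :=
  ⟨fst ∘ fst, ⟨snd ∘ fst, snd⟩⟩.
Arguments alpha {C A B D}.

Definition alphaV (C : ccategory) (A B D : C) :
    hom (A × (B × D)) ((A × B) × D) :=
  ⟨⟨fst, fst ∘ snd⟩, snd ∘ snd⟩.
Arguments alphaV {C A B D}.

Definition sigma (C : ccategory) (D A E : C) :
    hom (D × (A × E)) (A × (D × E)) :=
  ⟨fst ∘ snd, ⟨fst, snd ∘ snd⟩⟩.
Arguments sigma {C D A E}.

Definition push (C : ccategory) (D B E : C) :
    hom (D × (B ⇒ E)) (B ⇒ (D × E)) :=
  curry ⟨fst ∘ fst, ev ∘ ⟨snd ∘ fst, snd⟩⟩.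
Arguments push {C D B E}.

(** * Models *)

(* [bx t] is the endofunctor [t], [dm t] is ⟨t⟩; inverses of natural
   isomorphisms are marked V; [adj_unit] and [adj_counit] are those of
   ⟨t⟩ ⊣ [t]. *)
Record temporal : Type := Temporal {
  tcat :> ccategory;

  bx : nat -> endofunctor tcat;
  bx_le : forall m n, m <= n -> forall A, hom (bx m A) (bx n A);
  bx_le_nat : forall m n (h : m <= n) A B (f : hom A B),
    fmap (bx n) f ∘ bx_le h A = bx_le h B ∘ fmap (bx m) f;
  bx_le_id : forall n (h : n <= n) A, bx_le h A = id_;
  bx_le_comp : forall m n p (h : m <= n) (h' : n <= p) (h'' : m <= p) A,
    bx_le h' A ∘ bx_le h A = bx_le h'' A;

  eps : forall A, hom (bx 0 A) A;
  epsV : forall A, hom A (bx 0 A);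
  epsK : forall A, epsV A ∘ eps A = id_;
  epsVK : forall A, eps A ∘ epsV A = id_;
  eps_nat : forall A B (f : hom A B), f ∘ eps A = eps B ∘ fmap (bx 0) f;

  delta : forall A t1 t2, hom (bx (t1 + t2) A) (bx t1 (bx t2 A));
  deltaV : forall A t1 t2, hom (bx t1 (bx t2 A)) (bx (t1 + t2) A);
  deltaK : forall A t1 t2, deltaV A t1 t2 ∘ delta A t1 t2 = id_;
  deltaVK : forall A t1 t2, delta A t1 t2 ∘ deltaV A t1 t2 = id_;
  delta_nat : forall A B (f : hom A B) t1 t2,
    fmap (bx t1) (fmap (bx t2) f) ∘ delta A t1 t2 =
    delta B t1 t2 ∘ fmap (bx (t1 + t2)) f;

  eps_delta : forall A t,
    eps (bx t A) ∘ delta A 0 t = gcast (fun s => bx s A) (add0n t);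
  fmap_eps_delta : forall A t,
    fmap (bx t) (eps A) ∘ delta A t 0 = gcast (fun s => bx s A) (addn0 t);
  delta_delta : forall A t1 t2 t3,
    delta (bx t3 A) t1 t2 ∘ delta A (t1 + t2) t3 =
    fmap (bx t1) (delta A t2 t3) ∘ delta A t1 (t2 + t3)
      ∘ gcast (fun s => bx s A) (esym (addnA t1 t2 t3));
  delta_le : forall A t1 t1' t2 t2' (h1 : t1 <= t1') (h2 : t2 <= t2'),
    fmap (bx t1') (bx_le h2 A) ∘ bx_le h1 (bx t2 A) ∘ delta A t1 t2 =
    delta A t1' t2' ∘ bx_le (leq_add h1 h2) A;

  dm : nat -> endofunctor tcat;
  dm_le : forall m n, m <= n -> forall A, hom (dm n A) (dm m A);
  dm_le_nat : forall m n (h : m <= n) A B (f : hom A B),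
    fmap (dm m) f ∘ dm_le h A = dm_le h B ∘ fmap (dm n) f;
  dm_le_id : forall n (h : n <= n) A, dm_le h A = id_;
  dm_le_comp : forall m n p (h : m <= n) (h' : n <= p) (h'' : m <= p) A,
    dm_le h A ∘ dm_le h' A = dm_le h'' A;

  eta : forall A, hom A (dm 0 A);
  etaV : forall A, hom (dm 0 A) A;
  etaK : forall A, etaV A ∘ eta A = id_;
  etaVK : forall A, eta A ∘ etaV A = id_;
  eta_nat : forall A B (f : hom A B), fmap (dm 0) f ∘ eta A = eta B ∘ f;

  mu : forall A t1 t2, hom (dm t1 (dm t2 A)) (dm (t1 + t2) A);
  muV : forall A t1 t2, hom (dm (t1 + t2) A) (dm t1 (dm t2 A));
  muK : forall A t1 t2, muV A t1 t2 ∘ mu A t1 t2 = id_;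
  muVK : forall A t1 t2, mu A t1 t2 ∘ muV A t1 t2 = id_;
  mu_nat : forall A B (f : hom A B) t1 t2,
    fmap (dm (t1 + t2)) f ∘ mu A t1 t2 =
    mu B t1 t2 ∘ fmap (dm t1) (fmap (dm t2) f);

  mu_eta : forall A t,
    mu A 0 t ∘ eta (dm t A) = gcast (fun s => dm s A) (esym (add0n t));
  mu_fmap_eta : forall A t,
    mu A t 0 ∘ fmap (dm t) (eta A) = gcast (fun s => dm s A) (esym (addn0 t));
  mu_mu : forall A t1 t2 t3,
    mu A (t1 + t2) t3 ∘ mu (dm t3 A) t1 t2 =
    gcast (fun s => dm s A) (addnA t1 t2 t3)
      ∘ (mu A t1 (t2 + t3) ∘ fmap (dm t1) (mu A t2 t3));
  mu_le : forall A t1 t1' t2 t2' (h1 : t1 <= t1') (h2 : t2 <= t2'),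
    mu A t1 t2 ∘ fmap (dm t1) (dm_le h2 A) ∘ dm_le h1 (dm t2' A) =
    dm_le (leq_add h1 h2) A ∘ mu A t1' t2';

  adj_unit : forall A t, hom A (bx t (dm t A));
  adj_counit : forall A t, hom (dm t (bx t A)) A;
  adj_unit_nat : forall A B (f : hom A B) t,
    fmap (bx t) (fmap (dm t) f) ∘ adj_unit A t = adj_unit B t ∘ f;
  adj_counit_nat : forall A B (f : hom A B) t,
    f ∘ adj_counit A t = adj_counit B t ∘ fmap (dm t) (fmap (bx t) f);
  adj_triangle_dm : forall A t,
    adj_counit (dm t A) t ∘ fmap (dm t) (adj_unit A t) = id_;
  adj_triangle_bx : forall A t,
    fmap (bx t) (adj_counit A t) ∘ adj_unit (bx t A) t = id_;

  adj_unit_le : forall A t,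
    fmap (bx t) (dm_le (leq0n t) A) ∘ adj_unit A t ∘ etaV A ∘ eps (dm 0 A) =
    bx_le (leq0n t) (dm 0 A);
  adj_counit_le : forall A t,
    fmap (dm 0) (bx_le (leq0n t) A) ∘ eta (bx 0 A) ∘ epsV A ∘ adj_counit A t =
    dm_le (leq0n t) (bx t A);
  adj_unit_add : forall A t1 t2,
    fmap (bx t1) (fmap (bx t2) (gcast (fun s => dm s A) (addnC t2 t1) ∘ mu A t2 t1))
      ∘ fmap (bx t1) (adj_unit (dm t1 A) t2) ∘ adj_unit A t1 =
    delta (dm (t1 + t2) A) t1 t2 ∘ adj_unit A (t1 + t2);
  adj_counit_add : forall A t1 t2,
    adj_counit A t1 ∘ fmap (dm t1) (adj_counit (bx t1 A) t2)
      ∘ fmap (dm t1) (fmap (dm t2)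
          (delta A t2 t1 ∘ gcast (fun s => bx s A) (addnC t1 t2))) =
    adj_counit A (t1 + t2) ∘ mu (bx (t1 + t2) A) t1 t2
}.

(* The inverse of ⟨[t]fst, [t]snd⟩, as given by the adjunction ⟨t⟩ ⊣ [t]
   (see [mboxK], [mboxVK]). *)
Definition mbox (C : temporal) (A B : C) (t : nat) :
    hom (bx C t A × bx C t B) (bx C t (A × B)) :=
  fmap (bx C t) ⟨adj_counit A t ∘ fmap (dm C t) fst,
                 adj_counit B t ∘ fmap (dm C t) snd⟩
    ∘ adj_unit (bx C t A × bx C t B) t.
Arguments mbox {C A B t}.

Lemma pair_comp (C : ccategory) (D' D A B : C) (f : hom D A) (g : hom D B)
    (h : hom D' D) : ⟨f, g⟩ ∘ h = ⟨f ∘ h, g ∘ h⟩.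
Proof.
by rewrite (pair_uniq (⟨f, g⟩ ∘ h)) -!comp_assoc fst_pair snd_pair.
Qed.

Lemma mboxVK (C : temporal) (A B : C) (t : nat) :
  ⟨fmap (bx C t) fst, fmap (bx C t) snd⟩ ∘ mbox = idm (bx C t A × bx C t B).
Proof.
rewrite pair_comp /mbox -!comp_assoc -!fmap_comp fst_pair snd_pair.
rewrite !fmap_comp !comp_assoc !adj_unit_nat -!comp_assoc !adj_triangle_bx.
by rewrite [RHS]pair_uniq !comp_idl !comp_idr.
Qed.

Lemma mboxK (C : temporal) (A B : C) (t : nat) :
  mbox ∘ ⟨fmap (bx C t) fst, fmap (bx C t) snd⟩ = idm (bx C t (A × B)).
Proof.
rewrite /mbox comp_assoc -adj_unit_nat -comp_assoc -fmap_comp pair_comp.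
rewrite !comp_assoc -!fmap_comp fst_pair snd_pair -!adj_counit_nat -pair_comp.
have -> : ⟨fst, snd⟩ = idm (A × B).
  by rewrite [RHS]pair_uniq !comp_idr.
by rewrite comp_idl adj_triangle_bx.
Qed.

Definition eps_dm (C : temporal) (A : C) (t : nat) : hom (dm C t A) A :=
  etaV A ∘ dm_le (leq0n t) A.
Arguments eps_dm {C A t}.

Record graded : Type := Graded {
  gtemp :> temporal;
  T : nat -> endofunctor gtemp;

  etaT : forall A, hom A (T 0 A);
  etaT_nat : forall A B (f : hom A B), fmap (T 0) f ∘ etaT A = etaT B ∘ f;
  muT : forall A t1 t2, hom (T t1 (T t2 A)) (T (t1 + t2) A);
  muT_nat : forall A B (f : hom A B) t1 t2,
    fmap (T (t1 + t2)) f ∘ muT A t1 t2 = muT B t1 t2 ∘ fmap (T t1) (fmap (T t2) f);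
  strT : forall A B t, hom (bx gtemp t A × T t B) (T t (A × B));
  strT_nat : forall A A' B B' (f : hom A A') (g : hom B B') t,
    fmap (T t) (f ×m g) ∘ strT A B t =
    strT A' B' t ∘ (fmap (bx gtemp t) f ×m fmap (T t) g);

  muT_eta : forall A t,
    muT A 0 t ∘ etaT (T t A) = gcast (fun s => T s A) (esym (add0n t));
  muT_fmap_eta : forall A t,
    muT A t 0 ∘ fmap (T t) (etaT A) = gcast (fun s => T s A) (esym (addn0 t));
  muT_muT : forall A t1 t2 t3,
    muT A (t1 + t2) t3 ∘ muT (T t3 A) t1 t2 =
    gcast (fun s => T s A) (addnA t1 t2 t3)
      ∘ (muT A t1 (t2 + t3) ∘ fmap (T t1) (muT A t2 t3));

  strT_eta : forall A B, strT A B 0 ∘ (epsV A ×m etaT B) = etaT (A × B);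
  strT_snd : forall A B t, fmap (T t) snd ∘ strT A B t = snd;
  strT_mu : forall A B t1 t2,
    muT (A × B) t1 t2 ∘ fmap (T t1) (strT A B t2)
      ∘ strT (bx gtemp t2 A) (T t2 B) t1 =
    strT A B (t1 + t2) ∘ (deltaV A t1 t2 ×m muT B t1 t2);
  strT_assoc : forall A B D t,
    fmap (T t) alpha ∘ strT (A × B) D t ∘ (mbox ×m id_) ∘ alphaV =
    strT A (B × D) t ∘ (id_ ×m strT B D t)
}.

Fixpoint tyi (C : graded) (base : Type) (bi : base -> C) (X : vty base) : C :=
  match X with
  | VBase b => bi b
  | VUnit => one C
  | VProd X Y => tyi bi X × tyi bi Y
  | VArr X Y t => tyi bi X ⇒ T C t (tyi bi Y)
  | VBox t X => bx C t (tyi bi X)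
  end.

(* The n-ary product ⟦A_1⟧ × ... × ⟦A_n⟧ in the interpretation of constants is
   the product indexed by 'I_n. *)
Record algebraic (S : signature) : Type := Algebraic {
  agraded :> graded;
  basei : base_ty S -> agraded;
  consti : forall f : const_sym S,
    hom (iprod (fun i : 'I_(arity f) => tyi basei (const_dom i)))
        (tyi basei (const_cod f));
  ini (o : op_sym S) := tyi basei (op_in o);
  outi (o : op_sym S) := tyi basei (op_out o);

  opT : forall (o : op_sym S) A t,
    hom (ini o × bx agraded (op_time o) (outi o ⇒ T agraded t A))
        (T agraded (op_time o + t) A);
  opT_nat : forall o A B (f : hom A B) t,
    fmap (T agraded (op_time o + t)) f ∘ opT o A t =
    opT o B t
      ∘ (id_ ×m fmap (bx agraded (op_time o))
                  (expmap (outi o) (fmap (T agraded t) f)));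
  delayT : forall A t' t,
    hom (bx agraded t (T agraded t' A)) (T agraded (t + t') A);
  delayT_nat : forall A B (f : hom A B) t' t,
    fmap (T agraded (t + t')) f ∘ delayT A t' t =
    delayT B t' t ∘ fmap (bx agraded t) (fmap (T agraded t') f);

  muT_op : forall o A t t',
    muT A (op_time o + t) t' ∘ opT o (T agraded t' A) t =
    gcast (fun s => T agraded s A) (addnA (op_time o) t t')
      ∘ (opT o A (t + t')
           ∘ (id_ ×m fmap (bx agraded (op_time o))
                       (expmap (outi o) (muT A t t'))));
  muT_delay : forall A t t' t'',
    muT A (t + t') t'' ∘ delayT (T agraded t'' A) t' t =
    gcast (fun s => T agraded s A) (addnA t t' t'')
      ∘ (delayT A (t' + t'') t ∘ fmap (bx agraded t) (muT A t' t''));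
  strT_op : forall o A B t,
    strT A B (op_time o + t) ∘ (id_ ×m opT o B t) =
    opT o (A × B) t
      ∘ (id_ ×m (fmap (bx agraded (op_time o))
                   (expmap (outi o) (strT A B t) ∘ push)
                 ∘ mbox ∘ (delta A (op_time o) t ×m id_)))
      ∘ sigma;
  strT_delay : forall A B t t',
    strT A B (t + t') ∘ (id_ ×m delayT B t' t) =
    delayT (A × B) t' t ∘ fmap (bx agraded t) (strT A B t')
      ∘ mbox ∘ (delta A t t' ×m id_)
}.

(* the object 𝓗_A *)
Definition clauses (S : signature) (C : algebraic S) (A : C) : C :=
  iprod (fun o : op_sym S => iprod (fun t'' : nat =>
    (ini C o × bx C (op_time o) (outi C o ⇒ T C t'' A))
    ⇒ T C (op_time o + t'') A)).

(* [handle_kappa] is the morphism κ, with [h] for uncurry(χ_{A,t,t'}). *)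
Definition handle_kappa (S : signature) (C : algebraic S) (o : op_sym S)
    (H D E : C) (h : hom (H × D) E) :
    hom (H × bx C (op_time o) (outi C o ⇒ D)) (bx C (op_time o) (outi C o ⇒ E)) :=
  fmap (bx C (op_time o)) (expmap (outi C o) h ∘ push ∘ (eps_dm ×m id_))
    ∘ mbox ∘ (adj_unit H (op_time o) ×m id_).

Record model (S : signature) : Type := Model {
  malg :> algebraic S;
  chi : forall (A : malg) t t',
    hom (clauses A) (T malg t (T malg t' A) ⇒ T malg (t + t') A);
  chi_return : forall (A : malg) t,
    uncurry (chi A 0 t) ∘ (id_ ×m etaT (T malg t A)) =
    gcast (fun s => T malg s A) (esym (add0n t)) ∘ snd;
  chi_delay : forall (A : malg) t t' t'',
    uncurry (chi A (t + t') t'') ∘ (id_ ×m delayT (T malg t'' A) t' t) =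
    gcast (fun s => T malg s A) (addnA t t' t'')
      ∘ (delayT A (t' + t'') t
           ∘ fmap (bx malg t) (uncurry (chi A t' t'') ∘ (eps_dm ×m id_))
           ∘ mbox ∘ (adj_unit (clauses A) t ×m id_));
  chi_op : forall (A : malg) (o : op_sym S) t t',
    uncurry (chi A (op_time o + t) t') ∘ (id_ ×m opT o (T malg t' A) t) =
    gcast (fun s => T malg s A) (addnA (op_time o) t t')
      ∘ (ev ∘ ⟨proj (t + t') ∘ proj o ∘ fst,
               (id_ ×m handle_kappa o (uncurry (chi A t t'))) ∘ sigma⟩)
}.

(** * Interpretation *)

Section Interpretation.
Context (S : signature) (C : model S).

Notation "⟦ X ⟧" := (tyi (@basei S C) X) (at level 0, format "⟦ X ⟧").

(* the object part of the functor ⟦G⟧ *)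
Fixpoint ctxi (G : ctx (base_ty S)) (A : C) : C :=
  match G with
  | Empty => A
  | G ▹ X => ctxi G A × ⟦X⟧
  | G ⊳⟨ t ⟩ => dm C t (ctxi G A)
  end.

Fixpoint iota (G G' : ctx (base_ty S)) (A : C) :
    hom (ctxi (ctx_cat G G') A) (ctxi G' (ctxi G A)) :=
  match G' return hom (ctxi (ctx_cat G G') A) (ctxi G' (ctxi G A)) with
  | Empty => id_
  | G' ▹ X => iota G G' A ×m id_
  | G' ⊳⟨ t ⟩ => fmap (dm C t) (iota G G' A)
  end.

Fixpoint ctx_e (A : C) (G : ctx (base_ty S)) :
    hom (ctxi G A) (dm C (ctime G) A) :=
  match G return hom (ctxi G A) (dm C (ctime G) A) with
  | Empty => eta A
  | G ▹ X => ctx_e A G ∘ fst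
  | G ⊳⟨ t ⟩ =>
      gcast (fun s => dm C s A) (addnC t (ctime G))
        ∘ mu A t (ctime G) ∘ fmap (dm C t) (ctx_e A G)
  end.

Lemma ctime_clock_sub (G : ctx (base_ty S)) (t t' : nat) :
  t <= ctime (G ⊳⟨ t' ⟩) -> t - t' <= ctime G.
Proof. by rewrite leq_subLR addnC. Qed.

Lemma not_leq_geq (m n : nat) : (m <= n) = false -> n <= m.
Proof. by move/negbT; rewrite -ltnNge => /ltnW. Qed.

Fixpoint eta_pra (G : ctx (base_ty S)) (A : C) :
    forall t, t <= ctime G -> hom (ctxi G A) (dm C t (ctxi (ctx_minus G t) A)) :=
  match G return forall t, t <= ctime G ->
      hom (ctxi G A) (dm C t (ctxi (ctx_minus G t) A)) with
  | Empty => fun t =>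
      match t return t <= 0 -> hom A (dm C t (ctxi (ctx_minus Empty t) A)) with
      | 0 => fun _ => eta _
      | _.+1 => fun h => False_rect _ (notF h)
      end
  | G ▹ X => fun t =>
      match t return t <= ctime (G ▹ X) ->
          hom (ctxi G A × ⟦X⟧) (dm C t (ctxi (ctx_minus (G ▹ X) t) A)) with
      | 0 => fun _ => eta _
      | s.+1 => fun h => @eta_pra G A s.+1 h ∘ fst
      end
  | G ⊳⟨ t' ⟩ => fun t =>
      match t return t <= ctime (G ⊳⟨ t' ⟩) ->
          hom (dm C t' (ctxi G A)) (dm C t (ctxi (ctx_minus (G ⊳⟨ t' ⟩) t) A)) with
      | 0 => fun _ => eta _
      | s.+1 => fun h =>
          match s.+1 <= t' as b return (s.+1 <= t') = b ->
              hom (dm C t' (ctxi G A))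
                  (dm C s.+1 (ctxi (if b then G ⊳⟨ t' - s.+1 ⟩
                                    else ctx_minus G (s.+1 - t')) A)) with
          | true => fun le =>
              muV (ctxi G A) s.+1 (t' - s.+1)
                ∘ gcast (fun r => dm C r (ctxi G A)) (esym (subnKC le))
          | false => fun gt =>
              gcast (fun r => dm C r (ctxi (ctx_minus G (s.+1 - t')) A))
                    (subnKC (not_leq_geq gt))
                ∘ mu (ctxi (ctx_minus G (s.+1 - t')) A) t' (s.+1 - t')
                ∘ fmap (dm C t') (eta_pra A (ctime_clock_sub h))
          end erefl
      end
  end.

Fixpoint vali (G : ctx (base_ty S)) (V : value S) (X : vty (base_ty S))
    (d : G ⊢v V : X) : hom (ctxi G (one C)) ⟦X⟧ :=
  match d in vtyped G V X return hom (ctxi G (one C)) ⟦X⟧ with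
  | TVar G X G' =>
      snd ∘ eps_dm ∘ ctx_e (ctxi (G ▹ X) (one C)) G' ∘ iota (G ▹ X) G' (one C)
  | TConst G f Vs dVs => consti C f ∘ tuple (fun i => vali (dVs i))
  | TUnit G => bang
  | TPair G V W X Y dV dW => ⟨vali dV, vali dW⟩
  | TFun G X M Y t dM => curry (compi dM)
  | TBox G t V X dV => fmap (bx C t) (vali dV) ∘ adj_unit (ctxi G (one C)) t
  end
with compi (G : ctx (base_ty S)) (M : computation S) (X : vty (base_ty S))
    (t : nat) (d : G ⊢c M : X ! t) : hom (ctxi G (one C)) (T C t ⟦X⟧) :=
  match d in ctyped G M X t return hom (ctxi G (one C)) (T C t ⟦X⟧) with
  | TReturn G V X dV => etaT ⟦X⟧ ∘ vali dV
  | TLet G M N X Y t t' dM dN =>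
      muT ⟦Y⟧ t t' ∘ fmap (T C t) (compi dN) ∘ strT _ ⟦X⟧ t
        ∘ ⟨adj_unit (ctxi G (one C)) t, compi dM⟩
  | TApp G V W X Y t dV dW => ev ∘ ⟨vali dV, vali dW⟩
  | TMatch G V N X Y Z t dV dN => compi dN ∘ alphaV ∘ ⟨id_, vali dV⟩
  | TOp G o V M X t dV dM =>
      opT o ⟦X⟧ t ∘ (id_ ×m fmap (bx C (op_time o)) (curry (compi dM)))
        ∘ ⟨vali dV, adj_unit (ctxi G (one C)) (op_time o)⟩
  | TDelay G t M X t' dM =>
      delayT ⟦X⟧ t' t ∘ fmap (bx C t) (compi dM)
        ∘ adj_unit (ctxi G (one C)) t
  | THandle G M H N X Y t t' dM dN dH =>
      uncurry (chi ⟦Y⟧ t t')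
        ∘ (tuple (fun o => tuple (fun t'' => curry (compi (dH o t'') ∘ alphaV)))
           ×m id_)
        ∘ (id_ ×m fmap (T C t) (compi dN))
        ∘ (id_ ×m strT _ ⟦X⟧ t)
        ∘ ⟨id_, ⟨adj_unit (ctxi G (one C)) t, compi dM⟩⟩
  | TUnbox G t V N X Y t' le dV dN =>
      compi dN ∘ (id_ ×m adj_counit ⟦X⟧ t) ∘ (id_ ×m fmap (dm C t) (vali dV))
        ∘ ⟨id_, eta_pra (one C) le⟩
  end.

End Interpretation.

(* Main.v *)
(* Substitutions are related to morphisms in the style of Fitch-style modal type
   theory: a substitution into a context [G] followed by a clock [t] consists of
   a substitution into [G] over some [G1], together with a "lock", i.e. a way in
   which the target context extends [G1] by at least [t] units of time; locks
   denote morphisms into ⟨t⟩⟦G1⟧.  The context [G - t] is the largest one from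
   which [G] can be locked for [t], which makes substitutions commute with
   unbox.  Induction on typing derivations then shows that substituting in a
   term precomposes its denotation, and with this each axiom of the equational
   theory becomes a computation with the laws of the model.  As the conclusion
   speaks of arbitrary derivations of both sides, it also needs that typing
   derivations are unique. *)

(* The obstacle is bookkeeping of grades: sums such as [t + t'] and [t' + t] are equal only
   propositionally. As ⟨-⟩ is functorial in the order, every cast between clock functors is an order
   morphism, so the coherence maps for clocks carry a free inequality instead of an equation. [T] is
   indexed discretely, so its casts stay; they are met by casts of typing derivations.

   A restriction [G - t] may cut a clock in two. This is why locks, besides adding variables and
   clocks, may enlarge the last clock of the smaller context.

   Going under a binder weakens the substituted values, and weakening is itself an instance of the
   substitution lemma. The circle is broken by proving the lemma for a class of values already known
   to be weakenable: variables first, whose weakening is composition of locks.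

   Derivations are data, yet are produced only by existential statements; rules with a family of
   premises therefore call for choice, and for extensionality to compare the resulting families. *)
From HB Require Import structures.
From mathcomp Require Import all_boot zify.
From Stdlib Require Import FunctionalExtensionality ClassicalEpsilon Eqdep.
Require Import Defs.

Set Implicit Arguments.
Unset Strict Implicit.
Unset Printing Implicit Defensive.

Local Open Scope cat_scope.

(** * Syntax *)

Scheme value_mind := Induction for value Sort Prop
  with computation_mind := Induction for computation Sort Prop.
Combined Scheme term_mind from value_mind, computation_mind.

Section Syntax.
Context (S : signature).
Implicit Types (V : value S) (M : computation S) (r : nat -> nat)
  (s : nat -> value S).

Lemma up_ren_comp r r' : up_ren r \o up_ren r' = up_ren (r \o r').
Proof. by apply: functional_extensionality => -[|n]. Qed.

Lemma up_ren_id : up_ren id = id.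
Proof. by apply: functional_extensionality => -[|n]. Qed.

Ltac term_congr up :=
  apply: term_mind => //=; intros; f_equal;
  try (apply: functional_extensionality => ?);
  match goal with IH : _ |- _ => by rewrite IH ?up end.

Lemma ren_ren :
  (forall V r r', ren_val r (ren_val r' V) = ren_val (r \o r') V) /\
  (forall M r r', ren_comp r (ren_comp r' M) = ren_comp (r \o r') M).
Proof. by term_congr up_ren_comp. Qed.

Lemma sub_Var :
  (forall V r, sub_val (@Var S \o r) V = ren_val r V) /\
  (forall M r, sub_comp (@Var S \o r) M = ren_comp r M).
Proof.
have up r : up_sub (@Var S \o r) = @Var S \o up_ren r.
  by apply: functional_extensionality => -[|n].
apply: term_mind => //=; intros; rewrite ?up; f_equal; auto;
  apply: functional_extensionality => i; auto.
Qed.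

Lemma ren_id : (forall V, ren_val id V = V) /\ (forall M, ren_comp id M = M).
Proof.
apply: term_mind => //=; intros; rewrite ?up_ren_id; f_equal; auto;
  apply: functional_extensionality => i; rewrite ?up_ren_id; auto.
Qed.

Lemma sub_ren :
  (forall V s r, sub_val s (ren_val r V) = sub_val (s \o r) V) /\
  (forall M s r, sub_comp s (ren_comp r M) = sub_comp (s \o r) M).
Proof.
have up s r : up_sub s \o up_ren r = up_sub (s \o r).
  by apply: functional_extensionality => -[|n].
by term_congr up.
Qed.

Lemma ren_sub :
  (forall V s r, ren_val r (sub_val s V) = sub_val (ren_val r \o s) V) /\
  (forall M s r, ren_comp r (sub_comp s M) = sub_comp (ren_val r \o s) M).
Proof.
have up s r : ren_val (up_ren r) \o up_sub s = up_sub (ren_val r \o s).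
  apply: functional_extensionality => -[|n] //=.
  by rewrite /weaken !ren_ren.1.
by term_congr up.
Qed.

Lemma weaken_weaken m n V : weaken m (weaken n V) = weaken (m + n) V.
Proof.
rewrite /weaken ren_ren.1; congr ren_val.
by apply: functional_extensionality => i /=; rewrite addnA.
Qed.

Lemma weaken0 V : weaken 0 V = V.
Proof. exact: ren_id.1. Qed.

(** An unbox term stores only the weakened value; uniqueness of derivations has to recover from it
    the value that was typed in the restricted context. *)
Lemma weaken_inj n : injective (@weaken S n).
Proof.
have weakenK V : ren_val (subn^~ n) (weaken n V) = V.
  rewrite /weaken ren_ren.1 -[RHS]ren_id.1; congr ren_val.
  by apply: functional_extensionality => i /=; rewrite addKn.
exact: (can_inj weakenK).
Qed.

Lemma up_sub_Var : up_sub (@Var S) = @Var S.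
Proof. by apply: functional_extensionality => -[|n]. Qed.
End Syntax.

(** * Categories and grades *)

(** Lets an equation for a composite of two arrows be applied inside a composite nested to the
    right. *)
Lemma comp_lassoc (C : category) (A B D E : C) (f : hom D E) (g : hom B D)
    (k : hom B E) (e : f ∘ g = k) (h : hom A B) : f ∘ (g ∘ h) = k ∘ h.
Proof. by rewrite -comp_assoc e. Qed.

Lemma gcast_id (C : category) (F : nat -> C) (n : nat) (e : n = n) :
  gcast F e = id_.
Proof. by rewrite (eq_irrelevance e (erefl n)). Qed.

(** * Cartesian closed structure *)

Section Cartesian.
Context (C : ccategory).
Implicit Types A B D E : C.

Lemma pair_fst_snd A B : ⟨fst, snd⟩ = idm (A × B).
Proof. by rewrite [RHS]pair_uniq !comp_idr. Qed.

Lemma pmap_pair D A A' B B' (f : hom A A') (g : hom B B') (a : hom D A)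
    (b : hom D B) : (f ×m g) ∘ ⟨a, b⟩ = ⟨f ∘ a, g ∘ b⟩.
Proof. by rewrite /pmap pair_comp !comp_assoc fst_pair snd_pair. Qed.

Lemma fst_pmap A A' B B' (f : hom A A') (g : hom B B') :
  fst ∘ (f ×m g) = f ∘ fst.
Proof. exact: fst_pair. Qed.

Lemma snd_pmap A A' B B' (f : hom A A') (g : hom B B') :
  snd ∘ (f ×m g) = g ∘ snd.
Proof. exact: snd_pair. Qed.

Lemma pmap_comp A A' A'' B B' B'' (f : hom A' A'') (g : hom B' B'')
    (f' : hom A A') (g' : hom B B') :
  (f ×m g) ∘ (f' ×m g') = (f ∘ f') ×m (g ∘ g').
Proof. by rewrite pmap_pair -!comp_assoc. Qed.

Lemma pmap_id A B : idm A ×m idm B = id_.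
Proof. by rewrite /pmap !comp_idl pair_fst_snd. Qed.

Lemma curry_comp D' D A B (f : hom (D × A) B) (h : hom D' D) :
  curry f ∘ h = curry (f ∘ (h ×m id_)).
Proof. by rewrite curry_nat /pmap comp_idl. Qed.

Lemma uncurry_comp D' D A B (g : hom D (A ⇒ B)) (h : hom D' D) :
  uncurry (g ∘ h) = uncurry g ∘ (h ×m id_).
Proof. by rewrite -{1}[g]uncurryK curry_comp curryK. Qed.

Lemma uncurry_pair D D' A B (g : hom D (A ⇒ B)) (a : hom D' D) (b : hom D' A) :
  uncurry g ∘ ⟨a, b⟩ = ev ∘ ⟨g ∘ a, b⟩.
Proof.
rewrite -[in LHS](comp_idl g) uncurry_comp comp_assoc pmap_pair.
by rewrite comp_idl.
Qed.

Lemma ev_curry D D' A B (f : hom (D × A) B) (a : hom D' D) (b : hom D' A) :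
  ev ∘ ⟨curry f ∘ a, b⟩ = f ∘ ⟨a, b⟩.
Proof. by rewrite -uncurry_pair curryK. Qed.

Lemma alpha_pair D' D A B (a : hom D' D) (b : hom D' A) (c : hom D' B) :
  alpha ∘ ⟨⟨a, b⟩, c⟩ = ⟨a, ⟨b, c⟩⟩.
Proof.
by rewrite /alpha !pair_comp !comp_assoc !fst_pair !snd_pair.
Qed.

Lemma alphaV_pair D' D A B (a : hom D' D) (b : hom D' A) (c : hom D' B) :
  alphaV ∘ ⟨a, ⟨b, c⟩⟩ = ⟨⟨a, b⟩, c⟩.
Proof.
by rewrite /alphaV !pair_comp !comp_assoc !snd_pair !fst_pair.
Qed.

Lemma alphaV_nat A A' B B' D D' (f : hom A A') (g : hom B B') (k : hom D D') :
  ((f ×m g) ×m k) ∘ alphaV = alphaV ∘ (f ×m (g ×m k)).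
Proof.
by rewrite {1}/alphaV {3 4}/pmap !pmap_pair pair_comp alphaV_pair !comp_assoc.
Qed.

Lemma sigma_pair D' D A B (a : hom D' D) (b : hom D' A) (c : hom D' B) :
  sigma ∘ ⟨a, ⟨b, c⟩⟩ = ⟨b, ⟨a, c⟩⟩.
Proof.
by rewrite /sigma !pair_comp !comp_assoc !snd_pair !fst_pair.
Qed.

Lemma expmap_curry D A B B' (f : hom B B') (m : hom (D × A) B) :
  expmap A f ∘ curry m = curry (f ∘ m).
Proof.
rewrite /expmap curry_comp; congr curry.
by rewrite comp_assoc /pmap ev_curry comp_idl pair_fst_snd comp_idr.
Qed.

Lemma expmap_push D D' A B E (f : hom (D' × B) E) (a : hom D D')
    (m : hom (D × A) B) :
  expmap A f ∘ (push ∘ ⟨a, curry m⟩) = curry (f ∘ ⟨a ∘ fst, m⟩).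
Proof.
rewrite /push curry_comp expmap_curry; congr (curry (_ ∘ _)).
rewrite pair_comp !comp_assoc pair_comp fst_pmap snd_pmap comp_idl.
rewrite comp_assoc fst_pmap -(comp_assoc fst) -(comp_assoc snd) fst_pair.
by rewrite snd_pair ev_curry pair_fst_snd comp_idr.
Qed.

Lemma tuple_comp I (F : I -> C) D D' (f : forall i, hom D (F i))
    (h : hom D' D) : tuple f ∘ h = tuple (fun i => f i ∘ h).
Proof. by apply: tuple_uniq => i; rewrite -comp_assoc proj_tuple. Qed.
End Cartesian.

(* All coherence isomorphisms between iterated [dm] are absorbed in these two
   families, in which every equation between grades is relaxed to [<=].  The
   definitions are locked because rewriting with associativity of composition
   would otherwise see through them. *)
HB.lock Definition join (C : temporal) (A : C) t1 t2 s (h : s <= t1 + t2) :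
    hom (dm C t1 (dm C t2 A)) (dm C s A) :=
  dm_le h A ∘ mu A t1 t2.

HB.lock Definition split (C : temporal) (A : C) t1 t2 s (h : t1 + t2 <= s) :
    hom (dm C s A) (dm C t1 (dm C t2 A)) :=
  muV A t1 t2 ∘ dm_le h A.

HB.lock Definition drop (C : temporal) (A : C) t : hom (dm C t A) A := eps_dm.
Arguments drop {C A t}.

(** * Coherence of nested clocks *)

Section Grades.
Context (C : temporal).
Implicit Types A B D E : C.

Lemma dm_le_irr m n (h h' : m <= n) A :
  dm_le h A = dm_le h' A :> hom (dm C n A) _.
Proof. by rewrite (eq_irrelevance h h'). Qed.

Lemma dm_le_cast m n (e : m = n) (h : n <= m) A :
  gcast (fun s => dm C s A) e = dm_le h A.
Proof. by subst n; rewrite dm_le_id. Qed.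

Lemma joinE A t1 t2 s (h : s <= t1 + t2) : join A h = dm_le h A ∘ mu A t1 t2.
Proof. by rewrite join.unlock. Qed.

Lemma join_nat A B (f : hom A B) t1 t2 s (h : s <= t1 + t2) :
  fmap (dm C s) f ∘ join A h = join B h ∘ fmap (dm C t1) (fmap (dm C t2) f).
Proof. by rewrite !joinE -comp_assoc dm_le_nat !comp_assoc mu_nat. Qed.

Lemma dm_le_join A t1 t2 s s' (h : s <= t1 + t2) (h' : s' <= s)
    (h'' : s' <= t1 + t2) : dm_le h' A ∘ join A h = join A h''.
Proof. by rewrite !joinE -comp_assoc (dm_le_comp h' h h''). Qed.

Lemma join_dm_le2 A t1 t2 t2' s (h : s <= t1 + t2) (h' : t2 <= t2')
    (h'' : s <= t1 + t2') :
  join A h ∘ fmap (dm C t1) (dm_le h' A) = join A h''.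
Proof.
rewrite !joinE comp_assoc; have := mu_le A (leqnn t1) h'.
rewrite dm_le_id comp_idr => ->.
by rewrite -comp_assoc (dm_le_comp _ _ h'').
Qed.

Lemma join_dm_le1 A t1 t1' t2 s (h : s <= t1 + t2) (h' : t1 <= t1')
    (h'' : s <= t1' + t2) :
  join A h ∘ dm_le h' (dm C t2 A) = join A h''.
Proof.
rewrite !joinE comp_assoc; have := mu_le A h' (leqnn t2).
rewrite dm_le_id fmap_id comp_idr => ->.
by rewrite -comp_assoc (dm_le_comp _ _ h'').
Qed.

(** By monotonicity of [mu], every order morphism slides to the outside; what remains is the
    associativity law, whose cast is one more order morphism. *)
Lemma join_join A t1 t2 t3 u w s (h1 : s <= t1 + w) (h2 : w <= t2 + t3)
    (h3 : s <= u + t3) (h4 : u <= t1 + t2) :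
  join A h1 ∘ fmap (dm C t1) (join A h2) = join A h3 ∘ join (dm C t3 A) h4.
Proof.
have h5 : s <= t1 + t2 + t3 by rewrite (leq_trans h3) // leq_add2r.
have h6 : s <= t1 + (t2 + t3) by rewrite addnA.
rewrite (joinE _ h2) (joinE _ h4) fmap_comp -!comp_assoc (join_dm_le2 _ _ _ h6).
rewrite (join_dm_le1 _ _ _ h5) !joinE !comp_assoc mu_mu.
have e : t1 + (t2 + t3) = t1 + t2 + t3 by rewrite addnA.
have h7 : t1 + t2 + t3 <= t1 + (t2 + t3) by rewrite e.
by rewrite (dm_le_cast _ h7) -!comp_assoc (dm_le_comp _ _ h6).
Qed.

Lemma join_eta1 A t s (h : s <= 0 + t) (h' : s <= t) :
  join A h ∘ eta (dm C t A) = dm_le h' A.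
Proof.
by rewrite joinE comp_assoc mu_eta gcast_id comp_idr; apply: dm_le_irr.
Qed.

Lemma join_eta2 A t s (h : s <= t + 0) (h' : s <= t) :
  join A h ∘ fmap (dm C t) (eta A) = dm_le h' A.
Proof.
rewrite joinE comp_assoc mu_fmap_eta.
have hc : t + 0 <= t by rewrite addn0.
by rewrite (dm_le_cast _ hc) (dm_le_comp _ _ h').
Qed.

Lemma mu_inj A B t1 t2 (f g : hom B (dm C t1 (dm C t2 A))) :
  mu A t1 t2 ∘ f = mu A t1 t2 ∘ g -> f = g.
Proof.
move=> e; rewrite -[f]comp_idl -[g]comp_idl -(muK A t1 t2).
by rewrite !comp_assoc e.
Qed.

Lemma mu_join A t1 t2 : mu A t1 t2 = join A (leqnn (t1 + t2)).
Proof. by rewrite joinE dm_le_id comp_idl. Qed.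

Lemma join_inj A B t1 t2 (f g : hom B (dm C t1 (dm C t2 A))) :
  join A (leqnn (t1 + t2)) ∘ f = join A (leqnn (t1 + t2)) ∘ g -> f = g.
Proof. by rewrite -mu_join; apply: mu_inj. Qed.

Lemma join_split A t1 t2 s s' (h : s' <= t1 + t2) (h' : t1 + t2 <= s)
    (h'' : s' <= s) : join A h ∘ split A h' = dm_le h'' A.
Proof.
rewrite joinE split.unlock comp_assoc -(comp_assoc (mu _ _ _)) muVK comp_idl.
exact: dm_le_comp.
Qed.

Lemma split_nat A B (f : hom A B) t1 t2 s (h : t1 + t2 <= s) :
  fmap (dm C t1) (fmap (dm C t2) f) ∘ split A h = split B h ∘ fmap (dm C s) f.
Proof.
apply: mu_inj; rewrite -[LHS]comp_assoc -mu_nat split.unlock.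
rewrite comp_assoc -(comp_assoc (mu A _ _)) muVK comp_idl dm_le_nat.
by rewrite comp_assoc -!(comp_assoc (mu B _ _)) muVK comp_idl.
Qed.

Lemma drop_nat A B (f : hom A B) t :
  drop ∘ fmap (dm C t) f = f ∘ @drop C A t.
Proof.
rewrite drop.unlock /eps_dm comp_assoc -dm_le_nat -!comp_assoc; congr (_ ∘ _).
(* Only [eta] is assumed natural; naturality of its inverse follows by cancelling [eta]. *)
have mono (D E : C) (f1 f2 : hom D E) : eta E ∘ f1 = eta E ∘ f2 -> f1 = f2.
  by move=> e; rewrite -[f1]comp_idl -[f2]comp_idl -(etaK E) !comp_assoc e.
by apply: mono; rewrite -[LHS]comp_assoc -[RHS]comp_assoc etaVK comp_idl
  -eta_nat comp_assoc etaVK comp_idr.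
Qed.

Lemma eta_drop A t : eta A ∘ drop = dm_le (leq0n t) A.
Proof. by rewrite drop.unlock /eps_dm -comp_assoc etaVK comp_idl. Qed.

Lemma drop_eta A : drop ∘ eta A = id_.
Proof. by rewrite drop.unlock /eps_dm dm_le_id comp_idr etaK. Qed.

Lemma drop_le A s t (h : s <= t) : drop ∘ dm_le h A = drop.
Proof.
by rewrite drop.unlock /eps_dm comp_assoc (dm_le_comp _ h (leq0n t)).
Qed.

Lemma drop_join A t1 t2 s (h : s <= t1 + t2) :
  drop ∘ join A h = drop ∘ @drop C (dm C t2 A) t1.
Proof.
have h0 : 0 <= 0 + t2 by [].
rewrite -(drop_le _ (leq0n s)) comp_assoc (dm_le_join _ _ _ (leq0n _)).
rewrite -(join_dm_le1 _ h0 (leq0n t1)) -eta_drop.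
rewrite (comp_lassoc (join_eta1 _ _ (leq0n t2))) -comp_assoc.
by rewrite drop_le.
Qed.

Lemma fmap_drop A t1 t2 s (h : s <= t1 + t2) (h' : s <= t1) :
  dm_le h' A ∘ fmap (dm C t1) (@drop C A t2) = join A h.
Proof.
have h0 : s <= t1 + 0 by rewrite addn0.
rewrite -(join_eta2 _ h0) comp_assoc -fmap_comp eta_drop.
by rewrite (join_dm_le2 _ _ _ h).
Qed.

Lemma dm_le_split A t a b t' (le : t + a <= b) (le' : t' + a <= b)
    (h : t' <= t) :
  dm_le h (dm C a A) ∘ split A le = split A le'.
Proof.
apply: join_inj; rewrite (join_split _ _ le').
have le3 : t' + a <= t + a by rewrite leq_add2r.
by rewrite -comp_assoc (join_dm_le1 _ _ _ le3) (join_split _ _ _ le').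
Qed.

Lemma eta_split A b a (le : 0 + a <= b) (le' : a <= b) :
  split A le = eta _ ∘ dm_le le' A :> hom (dm C b A) _.
Proof.
apply: join_inj; rewrite (join_split _ _ _ le) -comp_assoc.
by rewrite (join_eta1 _ _ (leqnn a)) dm_le_id comp_idl; apply: dm_le_irr.
Qed.

(** This and the next two equations are the coherence cases of [lock_pra_factor]. In each, composing
    with the invertible [join] turns both sides into a single map. Since subtraction is truncated,
    [le1] forces [t <= u]. *)
Lemma split_join A t u t' b b0 (le : t + t' <= b) (leb : b <= u + b0)
    (le1 : t + (u - t) <= u) (le2 : t' <= (u - t) + b0) :
  fmap (dm C t) (join A le2) ∘ split (dm C b0 A) le1 = split A le ∘ join A leb.
Proof.
have le3 : t + t' <= u + b0 := leq_trans le leb.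
have le4 : t + t' <= t + (u - t) + b0 by rewrite -addnA leq_add2l.
apply: join_inj; rewrite -!comp_assoc (join_join _ _ _ le4 (leqnn _)).
rewrite comp_assoc !(join_split _ _ _ le1) (join_dm_le1 _ _ _ le3).
by rewrite (join_split _ _ _ le) (dm_le_join _ _ _ le3).
Qed.

Lemma join_split_swap A t a b u b0 v (le : t + a <= b) (leb : b <= u + b0)
    (le2 : t <= u + v) (le3 : v + a <= b0) :
  join (dm C a A) le2 ∘ fmap (dm C u) (split A le3) = split A le ∘ join A leb.
Proof.
have le4 : t + a <= u + v + a by rewrite leq_add2r.
have le5 : t + a <= u + (v + a) by rewrite addnA.
have le6 : t + a <= u + b0 := leq_trans le leb.
apply: join_inj; rewrite -!comp_assoc -(join_join _ le5 (leqnn _)).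
rewrite comp_assoc -fmap_comp (join_split _ _ _ le3) (join_dm_le2 _ _ _ le6).
by rewrite (join_split _ _ _ le) (dm_le_join _ _ _ le6).
Qed.

Lemma split_split A t a b b0 b1 (le : t + a <= b) (leb : b + b0 <= b1)
    (le1 : t + (b1 - t) <= b1) (le2 : a + b0 <= b1 - t) :
  fmap (dm C t) (split A le2) ∘ split A le1 = split _ le ∘ split A leb.
Proof.
have le3 : t + a + b0 <= b + b0 by rewrite leq_add2r.
have le4 : t + a + b0 <= b1 := leq_trans le3 leb.
have le5 : t + a + b0 <= t + (a + b0) by rewrite addnA.
have le6 : t + a + b0 <= t + (b1 - t) by rewrite (leq_trans le5) // leq_add2l.
apply: join_inj; apply: join_inj; rewrite -!comp_assoc.
rewrite -(join_join _ le5 (leqnn _)) (comp_assoc (join _ le5)) -fmap_comp.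
rewrite (join_split _ _ _ le2) (join_dm_le2 _ _ _ le6) (join_split _ _ _ le4).
rewrite (join_join _ _ _ (leqnn _) (leqnn (t + a))).
rewrite (comp_assoc (join _ _)) (join_split _ _ _ le) (join_dm_le1 _ _ _ le3).
by rewrite (join_split _ _ _ le4).
Qed.
End Grades.

(** * Locks *)

Section Locks.
Context (S : signature) (C : model S).
Implicit Types (G : ctx (base_ty S)) (X Y : vty (base_ty S)) (V : value S).

Notation "⟪ G ⟫" := (ctxi G (one C)) (at level 0, format "⟪ G ⟫").

(* [lock G1 G t n h]: [G] extends [G1] by [n] variables and by clocks, through
   which at least [t] units of time pass.  The case [t = 0] is weakening; for
   [G1 = G - t] this is the context restriction of unbox. *)
Inductive lock : forall G1 G t, nat -> hom ⟪G⟫ (dm C t ⟪G1⟫) -> Prop :=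
| lock_refl G : @lock G G 0 0 (eta ⟪G⟫)
| lock_var G1 G X t n h : @lock G1 G t n h -> @lock G1 (G ▹ X) t n.+1 (h ∘ fst)
| lock_clock G1 G u t n h s (le : s <= u + t) : @lock G1 G t n h ->
    @lock G1 (G ⊳⟨ u ⟩) s n (join _ le ∘ fmap (dm C u) h)
| lock_grow G a b t (le : t + a <= b) :
    @lock (G ⊳⟨ a ⟩) (G ⊳⟨ b ⟩) t 0 (split ⟪G⟫ le).
Arguments lock {G1 G t} n h.

Lemma lock_eq G1 G t n n' (h h' : hom ⟪G⟫ (dm C t ⟪G1⟫)) :
  lock n h -> n = n' -> h = h' -> lock n' h'.
Proof. by move=> l <- <-. Qed.

Lemma lock_le G1 G t n (h : hom ⟪G⟫ (dm C t ⟪G1⟫)) t' (le : t' <= t) :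
  lock n h -> lock n (dm_le le _ ∘ h).
Proof.
move=> l; elim: l t' le => {G1 G t n h}.
- move=> G t' le; case: t' le => // le; rewrite dm_le_id comp_idl.
  exact: lock_refl.
- move=> G1 G X t n h _ IH t' le; rewrite -comp_assoc; exact/lock_var/IH.
- move=> G1 G u t n h s le l _ t' le'.
  have le'' := leq_trans le' le.
  by rewrite -comp_assoc (dm_le_join _ _ _ le''); apply: lock_clock.
- move=> G a b t le t' le'.
  have le'' : t' + a <= b by rewrite (leq_trans _ le) // leq_add2r.
  by rewrite (dm_le_split _ _ le''); apply: lock_grow.
Qed.

(* The case of [lock_comp] where the second argument is [lock_grow]. *)
Lemma lock_comp_grow G1 G t n (h : hom ⟪G⟫ (dm C t ⟪G1⟫)) :
  lock n h ->
  match G return hom ⟪G⟫ (dm C t ⟪G1⟫) -> Prop with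
  | G ⊳⟨ a ⟩ => fun h => forall b u s (le : u + a <= b) (le' : s <= u + t),
      lock (G := G ⊳⟨ b ⟩) n
        (join ⟪G1⟫ le' ∘ fmap (dm C u) h ∘ split ⟪G⟫ le)
  | _ => fun _ => True
  end h.
Proof.
case=> {G1 G t n h} //.
- case=> // G a b u s le le'.
  have le2 : s + a <= b by rewrite (leq_trans _ le) // leq_add2r -(addn0 u).
  apply: lock_eq (lock_grow _ le2) _ _ => //.
  have su : s <= u by rewrite -(addn0 u).
  by rewrite (join_eta2 _ _ su) (dm_le_split _ _ le2).
- move=> G1 G a t n h s0 le0 l b u s le le'.
  have le2 : s <= b + t.
    by rewrite (leq_trans le') // (leq_trans _ (leq_add le (leqnn t)))
      // -addnA leq_add2l.
  apply: lock_eq (lock_clock le2 l) _ _ => //.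
  have le3 : s <= (u + a) + t.
    by rewrite (leq_trans le') // -addnA leq_add2l.
  rewrite fmap_comp -comp_assoc (join_join _ _ _ le3 (leqnn _)) !comp_assoc.
  rewrite split_nat. rewrite (comp_lassoc (join_split _ _ _ le)).
  by rewrite -comp_assoc (join_dm_le1 _ _ _ le2).
- move=> G a b t le0 b' u s le le'.
  have le2 : s + a <= b'.
    rewrite (leq_trans _ le) // (leq_trans (leq_add le' (leqnn a))) //.
    by rewrite -addnA leq_add2l.
  apply: lock_eq (lock_grow _ le2) _ _ => //.
  apply: join_inj; rewrite (join_split _ _ _ le2).
  have le3 : s + a <= u + (t + a) by rewrite addnA leq_add2r.
  have le4 : s + a <= u + b by rewrite (leq_trans le3) // leq_add2l.
  rewrite -!comp_assoc -(join_join _ le3 (leqnn (t + a))) comp_assoc.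
  rewrite comp_assoc (comp_lassoc (esym (fmap_comp _ _ _))).
  rewrite (join_split _ _ _ le0).
  by rewrite -!comp_assoc (join_dm_le2 _ _ _ le4) (join_split _ _ _ le2).
Qed.

(** By induction on the outer lock [l']: each of its steps is replayed on top of the composite. Only
    [lock_grow] requires looking into the inner lock, because it changes a clock that the inner lock
    may have consumed. *)
Lemma lock_comp G1 G2 G3 t n t' n' (h : hom ⟪G2⟫ (dm C t ⟪G1⟫))
    (h' : hom ⟪G3⟫ (dm C t' ⟪G2⟫)) s (le : s <= t' + t) :
  lock n h -> lock n' h' -> lock (n' + n) (join _ le ∘ fmap (dm C t') h ∘ h').
Proof.
move=> l l'; elim: l' G1 t n h s le l => {G2 G3 t' n' h'}.
- move=> G G1 t n h s le l.
  rewrite comp_assoc eta_nat -comp_assoc (join_eta1 _ _ le).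
  exact: lock_le.
- move=> G2 G X t' n' h' _ IH G1 t n h s le l.
  by rewrite -comp_assoc; apply/lock_var/IH.
- move=> G2 G u t' n' h' s' le' _ IH G1 t n h s le l.
  have le2 : s <= u + (t' + t).
    by rewrite (leq_trans le) // addnA leq_add2r.
  apply: lock_eq (lock_clock le2 (IH _ _ _ _ _ (leqnn (t' + t)) l)) _ _ => //.
  rewrite !fmap_comp -!comp_assoc (join_join _ _ _ le le').
  by rewrite (comp_assoc (join _ le) (fmap _ _)) join_nat !comp_assoc.
- move=> G2 a b u le0 G1 t n h s le l.
  exact: (lock_comp_grow l).
Qed.
End Locks.

(** * Context restriction as the universal lock *)

Section Restriction.
Context (S : signature) (C : model S).
Implicit Types (G : ctx (base_ty S)) (X Y : vty (base_ty S)) (V : value S).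

Notation "⟪ G ⟫" := (ctxi G (one C)) (at level 0, format "⟪ G ⟫").
Notation pra := (eta_pra (one C)).

(* As [ctx_minus G 0] is not convertible to [G] unless [G] is a constructor,
   [eta_pra] is described by elimination principles rather than equations. *)
Lemma pra_zero G (le : 0 <= ctime G)
    (P : forall G1, hom ⟪G⟫ (dm C 0 ⟪G1⟫) -> Prop) :
  P G (eta _) -> P (ctx_minus G 0) (pra le).
Proof. by case: G le P. Qed.

(** [eta_pra] branches on a test and remembers its outcome, while its target context is chosen by
    the same test; the two can only be eliminated together. *)
Lemma if_convoy (b : bool) (Q : bool -> Type) (f : b = true -> Q true)
    (g : b = false -> Q false) (P : forall c, Q c -> Prop) :
  (forall e, P true (f e)) -> (forall e, P false (g e)) ->
  P b (match b as c return b = c -> Q c with true => f | false => g end erefl).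
Proof.
move=> Pf Pg; have H c (e : b = c) :
    P c (match c as c return b = c -> Q c with true => f | false => g end e).
  by case: c e.
exact: H.
Qed.

(** The casts in [eta_pra] become order morphisms and are absorbed in [split] and [join]. The
    premise [t.+1 + (u - t.+1) <= u] says [t.+1 <= u] in the form that [split] takes. *)
Lemma pra_clock G u t (le : t.+1 <= ctime (G ⊳⟨ u ⟩))
    (P : forall G1, hom ⟪G ⊳⟨ u ⟩⟫ (dm C t.+1 ⟪G1⟫) -> Prop) :
  (forall le' : t.+1 + (u - t.+1) <= u,
     P (G ⊳⟨ u - t.+1 ⟩) (split ⟪G⟫ le')) ->
  (u < t.+1 ->
   forall (le' : t.+1 - u <= ctime G) (le2 : t.+1 <= u + (t.+1 - u)),
     P (ctx_minus G (t.+1 - u)) (join _ le2 ∘ fmap (dm C u) (pra le'))) ->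
  P (ctx_minus (G ⊳⟨ u ⟩) t.+1) (pra le).
Proof.
move=> Hle Hgt /=.
apply: (if_convoy
  (Q := fun b => hom _ (dm C t.+1 ⟪if b then G ⊳⟨ u - t.+1 ⟩ else _⟫))
  (P := fun b => P (if b then _ else _))) => e.
  have le' : t.+1 + (u - t.+1) <= u by rewrite subnKC.
  have := Hle le'; congr P; rewrite split.unlock; congr (_ ∘ _).
  by rewrite (dm_le_cast _ le').
have le2 : t.+1 <= u + (t.+1 - u) by rewrite -leq_subLR.
have ut : u < t.+1 by rewrite ltnNge e.
have := Hgt ut (ctime_clock_sub le) le2; congr P.
by rewrite joinE (dm_le_cast _ le2).
Qed.

Lemma nvars_minus G t : nvars (ctx_minus G t) <= nvars G.
Proof.
elim: G t => [|G IH X|G IH u] [|t] //=; first exact: leqW.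
by case: ifP.
Qed.

Lemma ndropped_zero G : ndropped G 0 = 0.
Proof. by case: G => [|G X|G u]; rewrite /ndropped /= subnn. Qed.

Lemma ndropped_var G X t : ndropped (G ▹ X) t.+1 = (ndropped G t.+1).+1.
Proof. by rewrite /ndropped /= subSn // nvars_minus. Qed.

Lemma lock_pra G t (le : t <= ctime G) : lock (ndropped G t) (pra le).
Proof.
elim: G t le => [|G IH X|G IH u] [|t] le //=.
- exact: lock_refl.
- by rewrite ndropped_zero; exact: lock_refl.
- by rewrite ndropped_var; exact/lock_var/IH.
- by rewrite ndropped_zero; exact: lock_refl.
(* Unfolded so that the count depends on the restricted context alone, which [pra_clock]
   abstracts. *)
have -> : ndropped (G ⊳⟨ u ⟩) t.+1 =
    nvars G - nvars (ctx_minus (G ⊳⟨ u ⟩) t.+1) by [].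
apply: (@pra_clock G u t le (fun G1 h => lock (nvars G - nvars G1) h)).
  by move=> le' /=; rewrite subnn; apply: lock_grow.
by move=> _ le' le2; apply: lock_clock; apply: IH.
Qed.

Lemma lock_ctime G1 G t n (h : hom ⟪G⟫ (dm C t ⟪G1⟫)) :
  lock n h -> t <= ctime G.
Proof.
elim=> {G1 G t n h} //=.
- move=> G1 G u t n h s le _ IH; rewrite (leq_trans le) // addnC.
  by rewrite leq_add2r.
- move=> G a b t le; rewrite (leq_trans _ (leq_addl _ _)) //.
  exact: leq_trans (leq_addr _ _) le.
Qed.

(** [G2] and [hp] are left open so that the elimination principles can replace [ctx_minus G t] and
    its [eta_pra] by what they compute to. *)
Definition factors G1 G2 G n t a b (le : t + a <= b) (h : hom ⟪G⟫ (dm C b ⟪G1⟫))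
    (hp : hom ⟪G⟫ (dm C t ⟪G2⟫)) : Prop :=
  exists n' (h' : hom ⟪G2⟫ (dm C a ⟪G1⟫)),
    [/\ lock n' h', n = nvars G - nvars G2 + n'
      & fmap (dm C t) h' ∘ hp = split _ le ∘ h].

Lemma factors_zero G1 G b n (h : hom ⟪G⟫ (dm C b ⟪G1⟫)) a (le : 0 + a <= b)
    (le' : 0 <= ctime G) : lock n h -> factors n le h (pra le').
Proof.
move=> l; apply: (@pra_zero G le' (fun G2 => @factors G1 G2 G n 0 a b le h)).
have le1 : a <= b by [].
exists n, (dm_le le1 _ ∘ h); split; first exact: lock_le.
  by rewrite subnn.
by rewrite (eta_split _ _ le1) eta_nat comp_assoc.
Qed.

(* [G - t] is the largest context from which [G] can be locked for [t]. *)
Lemma lock_pra_factor G1 G b n (h : hom ⟪G⟫ (dm C b ⟪G1⟫)) t a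
    (le : t + a <= b) (le' : t <= ctime G) :
  lock n h -> factors n le h (pra le').
Proof.
move=> l; elim: l t a le le' => {G1 G b n h}
  [G|G1 G X b n h l IH|G1 G u b0 n h b leb l IH|G b0 b1 b leb] [|t] a le le'.
1,3,5,7: apply: factors_zero; by constructor.
- by [].
- have [n' [h' [l' e eh]]] := IH _ _ le le'.
  exists n', h'; split=> //; last by rewrite /= -!comp_assoc eh.
  by rewrite -/(ndropped (G ▹ X) t.+1) ndropped_var addSn; congr _.+1.
- apply: (@pra_clock G u t le' (fun G2 => @factors G1 G2 (G ⊳⟨ u ⟩) n _ a b le
    (join _ leb ∘ fmap (dm C u) h))) => [le1|ut le1 le2].
    (* The restriction ends inside the clock [u]; the remainder of [u] goes into the second
       factor. *)
    have tu : t.+1 <= u := leq_trans (leq_addr _ _) le1.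
    have le2 : a <= (u - t.+1) + b0.
      lia.
    exists n, (join _ le2 ∘ fmap (dm C (u - t.+1)) h); split.
    + exact: lock_clock.
    + by rewrite subnn.
    rewrite fmap_comp comp_assoc split_nat -!comp_assoc.
    by rewrite (split_join _ le leb).
  (* The restriction uses up [u] and continues inside the smaller lock. *)
  have le3 : (t.+1 - u) + a <= b0.
    lia.
  have [n' [h' [l' e eh]]] := IH _ _ le3 le1.
  exists n', h'; split=> //.
  rewrite -comp_assoc join_nat comp_assoc -fmap_comp eh fmap_comp -!comp_assoc.
  congr (_ ∘ _); exact: join_split_swap.
(* Here [t.+1 <= b <= b1], so the restriction never leaves the clock [b1] and the second case is
   contradictory. *)
- refine (@pra_clock G b1 t le' (fun G2 => @factors (G ⊳⟨ b0 ⟩) G2 (G ⊳⟨ b1 ⟩) 0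
    t.+1 a b le (split ⟪G⟫ leb)) _ _); last by lia.
  move=> le1.
  have le2 : a + b0 <= b1 - t.+1 by lia.
  exists 0, (split _ le2); split; [exact: lock_grow|by rewrite subnn|].
  exact: split_split.
Qed.
End Restriction.

(** * Denotations of the term formers *)

(* The semantics of the term formers with a time-graded premise, as operations
   on morphisms; locked for the same reason as [join]. *)
HB.lock Definition boxD (C : temporal) (D A : C) t (v : hom (dm C t D) A) :
    hom D (bx C t A) :=
  fmap (bx C t) v ∘ adj_unit D t.

HB.lock Definition bindD (C : graded) (D A B : C) t (m : hom D (T C t A))
    (n : hom (dm C t D × A) B) : hom D (T C t B) :=
  fmap (T C t) n ∘ strT _ A t ∘ ⟨adj_unit D t, m⟩.

HB.lock Definition opD (S : signature) (C : algebraic S) (o : op_sym S)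
    (D A : C) t (v : hom D (ini C o))
    (m : hom (dm C (op_time o) D × outi C o) (T C t A)) :
    hom D (T C (op_time o + t) A) :=
  opT o A t ∘ ⟨v, boxD (curry m)⟩.

HB.lock Definition delayD (S : signature) (C : algebraic S) (D A : C) t t'
    (m : hom (dm C t D) (T C t' A)) : hom D (T C (t + t') A) :=
  delayT A t' t ∘ boxD m.

HB.lock Definition handleD (S : signature) (C : model S) (D A : C) t t'
    (h : hom D (clauses A)) (m : hom D (T C t (T C t' A))) :
    hom D (T C (t + t') A) :=
  uncurry (chi A t t') ∘ ⟨h, m⟩.

(** * Boxing and the adjunction *)

Section Box.
Context (C : temporal).
Implicit Types A B D E : C.

Lemma boxDE D A t (v : hom (dm C t D) A) :
  boxD v = fmap (bx C t) v ∘ adj_unit D t.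
Proof. by rewrite boxD.unlock. Qed.

Lemma boxD_comp D' D A t (v : hom (dm C t D) A) (f : hom D' D) :
  boxD v ∘ f = boxD (v ∘ fmap (dm C t) f).
Proof. by rewrite !boxDE comp_assoc -adj_unit_nat -comp_assoc -fmap_comp. Qed.

Lemma fmap_boxD D A B t (f : hom A B) (v : hom (dm C t D) A) :
  fmap (bx C t) f ∘ boxD v = boxD (f ∘ v).
Proof. by rewrite !boxDE -comp_assoc -fmap_comp. Qed.

Lemma boxD_id D t : boxD id_ = adj_unit D t.
Proof. by rewrite boxDE fmap_id comp_idl. Qed.

Lemma mbox_boxD D A B t (v : hom (dm C t D) A) (w : hom (dm C t D) B) :
  mbox ∘ ⟨boxD v, boxD w⟩ = boxD ⟨v, w⟩.
Proof.
have -> : ⟨boxD v, boxD w⟩ =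
    ⟨fmap (bx C t) fst, fmap (bx C t) snd⟩ ∘ boxD ⟨v, w⟩.
  by rewrite pair_comp !fmap_boxD fst_pair snd_pair.
by rewrite -comp_assoc mboxK comp_idl.
Qed.

Lemma fmap_mbox_boxD D A B E t (v : hom (dm C t D) A) (w : hom (dm C t D) B)
    (f : hom (A × B) E) :
  fmap (bx C t) f ∘ mbox ∘ ⟨boxD v, boxD w⟩ = boxD (f ∘ ⟨v, w⟩).
Proof. by rewrite comp_assoc mbox_boxD fmap_boxD. Qed.

Lemma counit_boxD D A t (v : hom (dm C t D) A) :
  adj_counit A t ∘ fmap (dm C t) (boxD v) = v.
Proof.
rewrite boxDE fmap_comp -comp_assoc -adj_counit_nat comp_assoc.
by rewrite adj_triangle_dm comp_idr.
Qed.

(** The unit law relating the adjunction to the order, at grade 0, where both order morphisms are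
    identities. *)
Lemma adj_unit0 D : adj_unit D 0 = epsV (dm C 0 D) ∘ eta D.
Proof.
have := adj_unit_le D 0; rewrite dm_le_id fmap_id comp_idl bx_le_id => e.
rewrite -[RHS]comp_idl -e !comp_assoc -(comp_assoc (eps _)) epsVK comp_idl.
by rewrite etaK comp_idr.
Qed.

Lemma boxD0 D A (v : hom (dm C 0 D) A) : boxD v = epsV A ∘ v ∘ eta D.
Proof.
rewrite boxDE adj_unit0 -comp_assoc; congr (_ ∘ _).
rewrite -[LHS]comp_idl -(epsK A) !comp_assoc -(comp_assoc (eps A)) -eps_nat.
by rewrite comp_assoc epsVK comp_idr.
Qed.

(** Right adjoints compose in the opposite order to their left adjoints, so boxing for [t1] then
    [t2] meets the clocks as [t2 + t1]; [le] absorbs the commutation. *)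
Lemma delta_boxD D A t1 t2 (le : t1 + t2 <= t2 + t1)
    (v : hom (dm C (t1 + t2) D) A) :
  delta A t1 t2 ∘ boxD v = boxD (boxD (v ∘ join D le)).
Proof.
have := adj_unit_add D t1 t2.
rewrite (dm_le_cast _ le) -joinE => e.
by rewrite !boxDE -comp_assoc -delta_nat comp_assoc -e -!comp_assoc -!fmap_comp.
Qed.

Lemma deltaV_boxD D A t1 t2 (le : t1 + t2 <= t2 + t1)
    (v : hom (dm C (t1 + t2) D) A) :
  deltaV A t1 t2 ∘ boxD (boxD (v ∘ join D le)) = boxD v.
Proof. by rewrite -delta_boxD -comp_assoc deltaK comp_idl. Qed.

Lemma boxD_drop A t : boxD (@drop C A t) = bx_le (leq0n t) A ∘ epsV A.
Proof.
have := adj_unit_le A t => e.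
have {}e : fmap (bx C t) (dm_le (leq0n t) A) ∘ adj_unit A t =
    bx_le (leq0n t) (dm C 0 A) ∘ (epsV (dm C 0 A) ∘ eta A).
  rewrite -e !comp_assoc -(comp_assoc (eps _)) epsVK comp_idl etaK comp_idr.
  by [].
rewrite boxDE drop.unlock /eps_dm fmap_comp comp_assoc e -comp_assoc.
rewrite bx_le_nat comp_assoc; congr (_ ∘ _).
rewrite -[LHS]comp_idl -(epsK A) comp_assoc -(comp_assoc (eps A)) -eps_nat.
by rewrite !comp_assoc -(comp_assoc (eps _)) epsVK comp_idl etaK comp_idr.
Qed.

(** Together with [boxD_drop] this gives the η-law of unbox: unboxing and boxing again only drops
    the elapsed time. *)
Lemma bx_le_counit A t :
  bx_le (leq0n t) A ∘ epsV A ∘ adj_counit A t = @drop C (bx C t A) t.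
Proof.
rewrite drop.unlock /eps_dm -adj_counit_le -!comp_assoc.
have -> : etaV _ ∘ fmap (dm C 0) (bx_le (leq0n t) A) ∘ eta _ =
    bx_le (leq0n t) A.
  by rewrite comp_assoc eta_nat -comp_assoc etaK comp_idl.
by [].
Qed.
End Box.

(** * Sequencing through the graded strength *)

Section Bind.
Context (C : graded).
Implicit Types A B D E : C.

Lemma bindDE D A B t (m : hom D (T C t A)) (n : hom (dm C t D × A) B) :
  bindD m n = fmap (T C t) n ∘ (strT _ A t ∘ ⟨boxD id_, m⟩).
Proof. by rewrite bindD.unlock boxD_id comp_assoc. Qed.

Lemma strT_box D A B t (v : hom (dm C t D) B) (m : hom D (T C t A)) :
  strT B A t ∘ ⟨boxD v, m⟩ = bindD m (v ×m id_).
Proof.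
by rewrite bindDE -comp_assoc strT_nat fmap_id comp_assoc pmap_pair comp_idl
  fmap_boxD comp_idr.
Qed.

Lemma fmap_bindD D A B B' t (m : hom D (T C t A)) (n : hom (dm C t D × A) B)
    (f : hom B B') : fmap (T C t) f ∘ bindD m n = bindD m (f ∘ n).
Proof. by rewrite !bindDE -comp_assoc -fmap_comp. Qed.

Lemma bindD_comp D' D A B t (m : hom D (T C t A)) (n : hom (dm C t D × A) B)
    (f : hom D' D) :
  bindD m n ∘ f = bindD (m ∘ f) (n ∘ (fmap (dm C t) f ×m id_)).
Proof.
rewrite -fmap_bindD -strT_box bindDE !comp_assoc pair_comp boxD_comp.
by rewrite comp_idl.
Qed.

(** [strT_assoc] freed of its structural isomorphisms: boxed data next to a bind moves into the
    continuation. *)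
Lemma strT_box_bindD D A B E t (v : hom (dm C t D) B) (m : hom D (T C t A))
    (n : hom (dm C t D × A) E) :
  strT B E t ∘ ⟨boxD v, bindD m n⟩ = bindD m ⟨v ∘ fst, n⟩.
Proof.
have -> : ⟨boxD v, bindD m n⟩ = (fmap (bx C t) id_ ×m fmap (T C t) n)
    ∘ ((id_ ×m strT _ _ t) ∘ ⟨boxD v, ⟨boxD id_, m⟩⟩).
  by rewrite !pmap_pair fmap_id !comp_idl bindDE.
rewrite -comp_assoc -strT_nat comp_assoc -(comp_assoc (strT _ _ _)) -strT_assoc.
rewrite !comp_assoc alphaV_pair pmap_pair comp_idl mbox_boxD strT_box.
rewrite !fmap_bindD; congr bindD.
rewrite {2}/pmap pair_comp !comp_idl alpha_pair pmap_pair comp_idl.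
by rewrite pair_fst_snd comp_idr.
Qed.

Lemma bindD_bindD D A B E t (m : hom D (T C t A)) (n : hom (dm C t D × A) B)
    (k : hom (dm C t D × B) E) :
  bindD (bindD m n) k = bindD m (k ∘ ⟨fst, n⟩).
Proof.
by rewrite [LHS]bindDE strT_box_bindD fmap_bindD comp_idl.
Qed.

Lemma bindD_snd D A t (m : hom D (T C t A)) : bindD m snd = m.
Proof. by rewrite bindDE -comp_assoc strT_snd snd_pair. Qed.

Lemma bindD_etaT D A B (v : hom D A) (n : hom (dm C 0 D × A) B) :
  bindD (etaT A ∘ v) n = etaT B ∘ (n ∘ ⟨eta D, v⟩).
Proof.
rewrite bindDE boxD0 comp_idr.
have -> : ⟨epsV (dm C 0 D) ∘ eta D, etaT A ∘ v⟩ =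
    (epsV (dm C 0 D) ×m etaT A) ∘ ⟨eta D, v⟩ by rewrite pmap_pair.
by rewrite -(comp_assoc (strT _ _ _)) strT_eta -!comp_assoc etaT_nat.
Qed.

(** From [strT_mu]. The continuation now sits under two clocks with a variable between them; [fst]
    discards the variable and [join] merges the clocks. *)
Lemma bindD_muT D A B t t' (le : t + t' <= t' + t)
    (m : hom D (T C t (T C t' A))) (n : hom (dm C (t + t') D × A) B) :
  bindD (muT A t t' ∘ m) n =
  muT B t t' ∘
    bindD m (bindD snd (n ∘ ((join D le ∘ fmap (dm C t') fst) ×m id_))).
Proof.
rewrite bindDE -(deltaV_boxD le) comp_idl -pmap_pair -(comp_assoc (strT _ _ _)).
rewrite -strT_mu !comp_assoc strT_box -comp_assoc muT_nat !comp_assoc.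
rewrite !fmap_bindD; congr (_ ∘ bindD _ _).
rewrite [in strT _ _ _ ∘ _]/pmap boxD_comp strT_box comp_idl.
by rewrite fmap_bindD.
Qed.
End Bind.

(** * Algebraic operations and delays *)

Section Operations.
Context (S : signature) (C : algebraic S).
Implicit Types A B D E : C.

Lemma opDE o D A t (v : hom D (ini C o))
    (m : hom (dm C (op_time o) D × outi C o) (T C t A)) :
  opD v m = opT o A t ∘ ⟨v, boxD (curry m)⟩.
Proof. by rewrite opD.unlock. Qed.

Lemma delayDE D A t t' (m : hom (dm C t D) (T C t' A)) :
  delayD m = delayT A t' t ∘ boxD m.
Proof. by rewrite delayD.unlock. Qed.

Lemma fmap_opD o D A B t (v : hom D (ini C o))
    (m : hom (dm C (op_time o) D × outi C o) (T C t A)) (f : hom A B) :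
  fmap (T C (op_time o + t)) f ∘ opD v m = opD v (fmap (T C t) f ∘ m).
Proof.
rewrite !opDE -comp_assoc opT_nat comp_assoc pmap_pair comp_idl.
by rewrite fmap_boxD expmap_curry.
Qed.

Lemma opD_comp o D' D A t (v : hom D (ini C o))
    (m : hom (dm C (op_time o) D × outi C o) (T C t A)) (f : hom D' D) :
  opD v m ∘ f = opD (v ∘ f) (m ∘ (fmap (dm C (op_time o)) f ×m id_)).
Proof. by rewrite !opDE comp_assoc pair_comp boxD_comp curry_comp. Qed.

(** [strT_op] in terms of binding. Here [fst] is the semantic counterpart of [lift1]: the
    continuation does not see the result of the operation. *)
Lemma bindD_opD o D A B t (le : op_time o + t <= t + op_time o)
    (v : hom D (ini C o)) (m : hom (dm C (op_time o) D × outi C o) (T C t A))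
    (n : hom (dm C (op_time o + t) D × A) B) :
  bindD (opD v m) n =
  opD v (bindD m (n ∘ ((join D le ∘ fmap (dm C t) fst) ×m id_))).
Proof.
rewrite bindDE opDE.
have -> : ⟨boxD id_, opT o A t ∘ ⟨v, boxD (curry m)⟩⟩ =
    (id_ ×m opT o A t)
      ∘ ⟨boxD (idm (dm C (op_time o + t) D)), ⟨v, boxD (curry m)⟩⟩.
  by rewrite pmap_pair comp_idl.
rewrite -(comp_assoc (strT _ _ _)) strT_op (comp_assoc _ sigma) sigma_pair.
rewrite (comp_assoc (opT _ _ _)) pmap_pair (comp_assoc (_ ∘ mbox)) pmap_pair.
rewrite (delta_boxD le) !comp_idl fmap_mbox_boxD comp_assoc expmap_push.
rewrite boxD_comp strT_box.
by rewrite -opDE fmap_opD fmap_bindD.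
Qed.

Lemma muT_opD o D A t t' (v : hom D (ini C o))
    (m : hom (dm C (op_time o) D × outi C o) (T C t (T C t' A))) :
  muT A (op_time o + t) t' ∘ opD v m =
  gcast (fun s => T C s A) (addnA (op_time o) t t') ∘ opD v (muT A t t' ∘ m).
Proof.
rewrite !opDE -comp_assoc muT_op !comp_assoc pmap_pair comp_idl.
by rewrite fmap_boxD expmap_curry.
Qed.

Lemma fmap_delayD D A B t t' (m : hom (dm C t D) (T C t' A)) (f : hom A B) :
  fmap (T C (t + t')) f ∘ delayD m = delayD (fmap (T C t') f ∘ m).
Proof. by rewrite !delayDE -comp_assoc delayT_nat comp_assoc fmap_boxD. Qed.

Lemma delayD_comp D' D A t t' (m : hom (dm C t D) (T C t' A)) (f : hom D' D) :
  delayD m ∘ f = delayD (m ∘ fmap (dm C t) f).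
Proof. by rewrite !delayDE comp_assoc boxD_comp. Qed.

Lemma bindD_delayD D A B t t' (le : t + t' <= t' + t)
    (m : hom (dm C t D) (T C t' A)) (n : hom (dm C (t + t') D × A) B) :
  bindD (delayD m) n = delayD (bindD m (n ∘ (join D le ×m id_))).
Proof.
rewrite bindDE delayDE.
have -> : ⟨boxD id_, delayT A t' t ∘ boxD m⟩ =
    (id_ ×m delayT A t' t) ∘ ⟨boxD (idm (dm C (t + t') D)), boxD m⟩.
  by rewrite pmap_pair comp_idl.
rewrite -(comp_assoc (strT _ _ _)) strT_delay.
rewrite (comp_assoc (_ ∘ mbox)) pmap_pair (delta_boxD le) !comp_idl.
rewrite 2!(comp_assoc (delayT _ _ _)) fmap_mbox_boxD strT_box.
by rewrite -delayDE fmap_delayD fmap_bindD.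
Qed.

Lemma muT_delayD D A t t' t'' (m : hom (dm C t D) (T C t' (T C t'' A))) :
  muT A (t + t') t'' ∘ delayD m =
  gcast (fun s => T C s A) (addnA t t' t'') ∘ delayD (muT A t' t'' ∘ m).
Proof.
by rewrite !delayDE -comp_assoc muT_delay !comp_assoc fmap_boxD.
Qed.
End Operations.

(** * Handling *)

Section Handlers.
Context (S : signature) (C : model S).
Implicit Types A B D E : C.

Lemma handleDE D A t t' (h : hom D (clauses A)) (m : hom D (T C t (T C t' A))) :
  handleD h m = uncurry (chi A t t') ∘ ⟨h, m⟩.
Proof. by rewrite handleD.unlock. Qed.

Lemma handleD_comp D' D A t t' (h : hom D (clauses A))
    (m : hom D (T C t (T C t' A))) (f : hom D' D) :
  handleD h m ∘ f = handleD (h ∘ f) (m ∘ f).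
Proof. by rewrite !handleDE comp_assoc pair_comp. Qed.

Lemma handleD_etaT D A t (h : hom D (clauses A)) (m : hom D (T C t A)) :
  handleD h (etaT _ ∘ m) = m :> hom D (T C t A).
Proof.
rewrite handleDE.
have -> : ⟨h, etaT _ ∘ m⟩ = (id_ ×m etaT _) ∘ ⟨h, m⟩.
  by rewrite pmap_pair comp_idl.
by rewrite -comp_assoc chi_return comp_assoc snd_pair gcast_id comp_idl.
Qed.

Lemma handleD_delayD D A t t' t'' (h : hom D (clauses A))
    (m : hom (dm C t D) (T C t' (T C t'' A))) :
  handleD h (delayD m) =
  gcast (fun s => T C s A) (addnA t t' t'') ∘ delayD (handleD (h ∘ drop) m).
Proof.
rewrite !handleDE !delayDE.
have -> : ⟨h, delayT _ t' t ∘ boxD m⟩ = (id_ ×m delayT _ t' t) ∘ ⟨h, boxD m⟩.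
  by rewrite pmap_pair comp_idl.
rewrite -comp_assoc chi_delay comp_assoc; congr (_ ∘ _).
rewrite comp_assoc pmap_pair comp_idl -boxD_id boxD_comp comp_idl.
rewrite 2!(comp_assoc (delayT _ _ _)).
rewrite fmap_mbox_boxD comp_assoc pmap_pair comp_idl.
have -> : eps_dm ∘ fmap (dm C t) h = h ∘ drop.
  by rewrite -drop_nat drop.unlock.
by [].
Qed.

(** The resumption runs the same handler after [op_time o] has passed and a result is bound, hence
    the clauses are weakened by [drop ∘ fst]. Both components fed to [mbox] in κ are boxed over one
    clock, so κ collapses to a single [boxD]. *)
Lemma handleD_opD o D A t t' (h : hom D (clauses A)) (v : hom D (ini C o))
    (m : hom (dm C (op_time o) D × outi C o) (T C t (T C t' A))) :
  handleD h (opD v m) =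
  gcast (fun s => T C s A) (addnA (op_time o) t t')
    ∘ (ev ∘ ⟨proj (t + t') ∘ (proj o ∘ h),
             ⟨v, boxD (curry (handleD (h ∘ (drop ∘ fst)) m))⟩⟩).
Proof.
rewrite !handleDE !opDE.
have -> : ⟨h, opT o _ t ∘ ⟨v, boxD (curry m)⟩⟩ =
    (id_ ×m opT o _ t) ∘ ⟨h, ⟨v, boxD (curry m)⟩⟩.
  by rewrite pmap_pair comp_idl.
rewrite -comp_assoc chi_op !comp_assoc; congr (_ ∘ (ev ∘ _)).
rewrite pair_comp !comp_assoc sigma_pair pmap_pair comp_idl fst_pair.
congr ⟨_, ⟨_, _⟩⟩.
rewrite /handle_kappa comp_assoc pmap_pair comp_idl -boxD_id boxD_comp comp_idl.
rewrite fmap_mbox_boxD !comp_assoc pmap_pair comp_idl expmap_push.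
have -> : eps_dm ∘ fmap (dm C (op_time o)) h = h ∘ drop.
  by rewrite -drop_nat drop.unlock.
by rewrite comp_assoc.
Qed.
End Handlers.

(** * Substitution *)

(** Selects one derivation per premise for constants and handler clauses, together with the equation
    for its denotation. *)
Lemma dependent_choice (I : Type) (A : I -> Type) (P : forall i, A i -> Prop) :
  (forall i, exists a, P i a) -> exists f, forall i, P i (f i).
Proof.
move=> h.
exists (fun i => proj1_sig (constructive_indefinite_description _ (h i))).
by move=> i; case: constructive_indefinite_description.
Qed.

Scheme vtyped_mind := Induction for vtyped Sort Prop
  with ctyped_mind := Induction for ctyped Sort Prop.
Combined Scheme typed_mind from vtyped_mind, ctyped_mind.

Section Denotations.
Context (S : signature) (C : model S).
Implicit Types (G : ctx (base_ty S)) (X Y : vty (base_ty S)) (V W : value S)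
  (M N : computation S).

Notation "⟦ X ⟧" := (tyi (@basei S C) X) (at level 0, format "⟦ X ⟧").
Notation "⟪ G ⟫" := (ctxi G (one C)) (at level 0, format "⟪ G ⟫").

Definition clausesi G H Y (dH : htyped G H Y) : hom ⟪G⟫ (clauses ⟦Y⟧) :=
  tuple (fun o => tuple (fun t => curry (compi C (dH o t) ∘ alphaV))).

Lemma proj_clausesi G H Y (dH : htyped G H Y) o t :
  proj t ∘ (proj o ∘ clausesi dH) = curry (compi C (dH o t) ∘ alphaV).
Proof.
rewrite /clausesi proj_tuple.
exact: (proj_tuple (fun t => curry (compi C (dH o t) ∘ alphaV)) t).
Qed.

Lemma vali_TFun G X M Y t (dM : G ▹ X ⊢c M : Y ! t) :
  vali C (TFun dM) = curry (compi C dM).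
Proof. by []. Qed.

Lemma vali_TBox G t V X (d : G ⊳⟨ t ⟩ ⊢v V : X) :
  vali C (TBox d) = boxD (vali C d).
Proof. by rewrite boxDE. Qed.

Lemma compi_TLet G M N X Y t t' (dM : G ⊢c M : X ! t)
    (dN : G ⊳⟨ t ⟩ ▹ X ⊢c N : Y ! t') :
  compi C (TLet dM dN) = muT _ t t' ∘ bindD (compi C dM) (compi C dN).
Proof. by rewrite bindDE boxD_id /= !comp_assoc. Qed.

Lemma compi_TMatch G V N X Y Z t (dV : G ⊢v V : VProd X Y)
    (dN : G ▹ X ▹ Y ⊢c N : Z ! t) :
  compi C (TMatch dV dN) = compi C dN ∘ (alphaV ∘ ⟨id_, vali C dV⟩).
Proof. exact: comp_assoc. Qed.

Lemma compi_TOp G o V M X t (dV : G ⊢v V : op_in o)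
    (dM : G ⊳⟨ op_time o ⟩ ▹ op_out o ⊢c M : X ! t) :
  compi C (TOp dV dM) = opD (D := ⟪G⟫) (vali C dV) (compi C dM).
Proof. by rewrite opDE boxDE /= comp_assoc pmap_pair comp_idl. Qed.

Lemma compi_TDelay G t M X t' (dM : G ⊳⟨ t ⟩ ⊢c M : X ! t') :
  compi C (TDelay dM) = delayD (compi C dM).
Proof. by rewrite delayDE boxDE /= !comp_assoc. Qed.

Lemma compi_THandle G M H N X Y t t' (dM : G ⊢c M : X ! t)
    (dN : G ⊳⟨ t ⟩ ▹ X ⊢c N : Y ! t') (dH : htyped G H Y) :
  compi C (THandle dM dN dH) =
  handleD (clausesi dH) (bindD (compi C dM) (compi C dN)).
Proof.
by rewrite handleDE bindDE boxD_id /= !comp_assoc !pmap_pair !comp_idl comp_idr.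
Qed.

Lemma compi_TUnbox G t V N X Y t' (le : t <= ctime G)
    (dV : ctx_minus G t ⊢v V : VBox t X) (dN : G ▹ X ⊢c N : Y ! t') :
  compi C (TUnbox le dV dN) =
  compi C dN ∘ ⟨id_, adj_counit ⟦X⟧ t ∘ (fmap (dm C t) (vali C dV)
    ∘ eta_pra (one C) le)⟩.
Proof. by rewrite /= !comp_assoc !pmap_pair !comp_idl. Qed.
End Denotations.

Section Substitution.
Context (S : signature) (C : model S).
Implicit Types (G : ctx (base_ty S)) (X Y : vty (base_ty S)) (V : value S).

Notation "⟦ X ⟧" := (tyi (@basei S C) X) (at level 0, format "⟦ X ⟧").
Notation "⟪ G ⟫" := (ctxi G (one C)) (at level 0, format "⟪ G ⟫").
Notation pra := (eta_pra (one C)).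

Lemma vali_TVar G X G' :
  vali C (TVar G X G') =
  snd ∘ (drop ∘ (ctx_e (ctxi (G ▹ X) (one C)) G' ∘ iota (G ▹ X) G' (one C))).
Proof. by rewrite drop.unlock -[RHS]comp_assoc -[RHS]comp_assoc. Qed.

Lemma ctx_e_clock (A : C) G t (le : ctime G + t <= t + ctime G) :
  ctx_e A (G ⊳⟨ t ⟩) = join A le ∘ fmap (dm C t) (ctx_e A G).
Proof. by rewrite /= joinE (dm_le_cast _ le). Qed.

(** Phrased for any [V], so that case analysis on the derivation is possible; only the variable rule
    survives. *)
Lemma var_ext G X V (d : G ⊢v V : X) Y :
  if V is Var n then
    exists d' : G ▹ Y ⊢v Var n.+1 : X, vali C d' = vali C d ∘ fst
  else True.
Proof.
case: G V X / d => // G X G'.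
exists (TVar G X (G' ▹ Y)); rewrite (vali_TVar G X (G' ▹ Y)) (vali_TVar G X G').
by rewrite /= !comp_assoc fst_pmap.
Qed.

Lemma var_clock G X V (d : G ⊢v V : X) u :
  if V is Var n then
    exists d' : G ⊳⟨ u ⟩ ⊢v Var n : X, vali C d' = vali C d ∘ drop
  else True.
Proof.
case: G V X / d => // G X G'.
have le : ctime G' + u <= u + ctime G' by rewrite addnC.
exists (TVar G X (G' ⊳⟨ u ⟩)).
rewrite (vali_TVar G X (G' ⊳⟨ u ⟩)) (vali_TVar G X G').
rewrite (ctx_e_clock _ le) /= !comp_assoc.
rewrite -fmap_comp (comp_lassoc (drop_join _ _)).
by rewrite !comp_assoc drop_nat !comp_assoc.
Qed.

(** With [typed_var_lock] as converse, variables are identified with locks from a context ending in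
    a variable. Weakening and substituting a variable thus become operations on locks. *)
Lemma lock_var_typed G1 G t n (h : hom ⟪G⟫ (dm C t ⟪G1⟫)) :
  lock n h ->
  match G1 return hom ⟪G⟫ (dm C t ⟪G1⟫) -> Prop with
  | G0 ▹ X => fun h =>
      exists d : G ⊢v Var n : X, vali C d = snd ∘ (drop ∘ h)
  | _ => fun _ => True
  end h.
Proof.
elim=> {G1 G t n h} //.
- case=> // G X; exists (TVar G X Empty).
  by rewrite (vali_TVar G X Empty) /= comp_idr.
- case=> // G1 X G Y t n h _ [d e].
  have [d' e'] := var_ext d Y.
  by exists d'; rewrite e' e !comp_assoc.
- case=> // G1 X G u t n h s le _ [d e].
  have [d' e'] := var_clock d u.
  exists d'; rewrite e' e !comp_assoc.
  by rewrite (comp_lassoc (drop_join _ _)) !comp_assoc drop_nat.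
Qed.

Lemma typed_var_lock G X V (d : G ⊢v V : X) :
  if V is Var n then
    exists G0 t (h : hom ⟪G⟫ (dm C t ⟪G0 ▹ X⟫)),
      lock n h /\ vali C d = snd ∘ (drop ∘ h)
  else True.
Proof.
case: G V X / d => // G X G'.
exists G, (ctime G'), (ctx_e _ G' ∘ iota (G ▹ X) G' (one C)).
split; last exact: vali_TVar.
elim: G' => [|G' IH Y|G' IH u].
- by rewrite comp_idr; apply: lock_refl.
- by rewrite /= comp_assoc fst_pmap -comp_assoc; apply: lock_var.
have le : ctime G' + u <= u + ctime G' by rewrite addnC.
rewrite (ctx_e_clock _ le) comp_assoc -fmap_comp.
exact: lock_clock.
Qed.

(* [K] is a class of values closed under weakening: the variables, which gives
   the renaming lemma, and then all values. *)
Context (K : value S -> Prop).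

Definition weakenable : Prop :=
  forall G1 G t k (h : hom ⟪G⟫ (dm C t ⟪G1⟫)) V X (d : G1 ⊢v V : X),
    K V -> lock k h ->
    K (weaken k V) /\
    exists d' : G ⊢v weaken k V : X, vali C d' = vali C d ∘ (drop ∘ h).

(* [subst_ok s σ]: the substitution [s] maps the variables of [G] to
   values over [G'] and denotes [σ].  Under a clock the values have to be
   typed in a context from which [G'] can be locked. *)
Fixpoint subst_ok G G' (s : nat -> value S) : hom ⟪G'⟫ ⟪G⟫ -> Prop :=
  match G return hom ⟪G'⟫ ⟪G⟫ -> Prop with
  | Empty => fun _ => True
  | G ▹ X => fun σ =>
      subst_ok (s \o succn) (fst ∘ σ) /\
      exists2 d : G' ⊢v s 0 : X, K (s 0) & vali C d = snd ∘ σ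
  | G ⊳⟨ t ⟩ => fun σ =>
      exists G1 k (h : hom ⟪G'⟫ (dm C t ⟪G1⟫)) s1 (σ1 : hom ⟪G1⟫ ⟪G⟫),
        [/\ lock k h, s = weaken k \o s1, subst_ok s1 σ1
          & σ = fmap (dm C t) σ1 ∘ h]
  end.

Hypothesis Kwk : weakenable.

Lemma subst_weaken G G' G'' s (σ : hom ⟪G'⟫ ⟪G⟫) t k
    (h : hom ⟪G''⟫ (dm C t ⟪G'⟫)) :
  subst_ok s σ -> lock k h ->
  subst_ok (weaken k \o s) (σ ∘ (drop ∘ h)).
Proof.
elim: G G' G'' s σ t k h => [//|G IH X|G IH u] G' G'' s σ t k h /=.
- move=> [os [d Ks e]] l; split.
    by have := IH _ _ _ _ _ _ _ os l; rewrite comp_assoc.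
  have [K' [d' e']] := Kwk d Ks l.
  by exists d' => //; rewrite e' e !comp_assoc.
move=> [G1 [k1 [h1 [s1 [σ1 [l1 -> os ->]]]]]] l.
(* The [t] units of the outer lock are surplus; [le] forgets them. *)
have le : u <= t + u by rewrite leq_addl.
exists G1, (k + k1), (join _ le ∘ fmap (dm C t) h1 ∘ h), s1, σ1; split=> //.
- exact: lock_comp.
- by apply: functional_extensionality => n; rewrite /= weaken_weaken.
(* Forgetting the outer [t] units passes through grade 0, where [join] cancels [eta]. *)
have h0 : u <= 0 + u by [].
rewrite -(join_dm_le1 _ h0 (leq0n t)) -eta_drop.
rewrite (comp_lassoc (join_eta1 _ _ (leqnn u))) dm_le_id comp_idl.
by rewrite drop_nat !comp_assoc.
Qed.

Hypothesis KVar0 : K (Var 0).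

Lemma subst_ext G G' X s (σ : hom ⟪G'⟫ ⟪G⟫) :
  subst_ok s σ ->
  subst_ok (G := G ▹ X) (G' := G' ▹ X) (up_sub s) (σ ×m id_).
Proof.
move=> os; split.
  rewrite fst_pmap; have := subst_weaken os (lock_var X (lock_refl C G')).
  by rewrite (comp_lassoc (drop_eta _)) comp_idl.
exists (TVar G' X Empty) => //.
rewrite (vali_TVar G' X Empty) /= comp_idr drop_eta comp_idr snd_pmap.
by rewrite comp_idl.
Qed.

Lemma subst_clock G G' t s (σ : hom ⟪G'⟫ ⟪G⟫) :
  subst_ok s σ ->
  subst_ok (G := G ⊳⟨ t ⟩) (G' := G' ⊳⟨ t ⟩) s (fmap (dm C t) σ).
Proof.
move=> os; have le : t <= t + 0 by rewrite addn0.
exists G', 0, (join _ le ∘ fmap (dm C t) (eta _)), s, σ; split=> //.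
- exact/lock_clock/lock_refl.
- by apply: functional_extensionality => n; rewrite /= weaken0.
by rewrite (join_eta2 _ _ (leqnn t)) dm_le_id comp_idr.
Qed.

Lemma subst_id G : subst_ok (@Var S) (idm ⟪G⟫).
Proof.
elim: G => [//|G IH X|G IH t].
  by rewrite -up_sub_Var -pmap_id; apply: subst_ext.
by have := subst_clock t IH; rewrite fmap_id.
Qed.

(** Locks can be pulled back along substitutions. A clock of [G] is matched in [G'] by the lock
    stored in [subst_ok], so most cases compose locks; [lock_grow] must instead cut the stored lock
    in two. *)
Lemma subst_lock G1 G t n (h : hom ⟪G⟫ (dm C t ⟪G1⟫)) :
  lock n h -> forall G' s (σ : hom ⟪G'⟫ ⟪G⟫), subst_ok s σ ->
  exists G1' n' (h' : hom ⟪G'⟫ (dm C t ⟪G1'⟫)) s1 (σ1 : hom ⟪G1'⟫ ⟪G1⟫),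
    [/\ lock n' h', s \o addn n = weaken n' \o s1, subst_ok s1 σ1
      & fmap (dm C t) σ1 ∘ h' = h ∘ σ].
Proof.
elim=> {G1 G t n h}.
- move=> G G' s σ os; exists G', 0, (eta _), s, σ; split=> //.
  + exact: lock_refl.
  + by apply: functional_extensionality => n; rewrite /= weaken0 add0n.
  exact: eta_nat.
- move=> G1 G X t n h _ IH G' s σ [os _].
  have [G1' [n' [h' [s1 [σ1 [l' es os1 eσ]]]]]] := IH _ _ _ os.
  exists G1', n', h', s1, σ1; split=> //; last by rewrite eσ comp_assoc.
- move=> G1 G u t n h r le _ IH G' s σ [G2 [k [h2 [s2 [σ2 [l2 -> os2 ->]]]]]].
  have [G1' [n' [h' [s1 [σ1 [l' es os1 eσ]]]]]] := IH _ _ _ os2.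
  exists G1', (k + n'), (join _ le ∘ fmap (dm C u) h' ∘ h2), s1, σ1; split=> //.
  + exact: lock_comp.
  + apply: functional_extensionality => i /=.
    by rewrite -weaken_weaken -[weaken n' _]/((weaken n' \o s1) i) -es.
  rewrite -!comp_assoc join_nat !comp_assoc; congr (_ ∘ _).
  by rewrite -!comp_assoc -!fmap_comp eσ.
move=> G a b t le G' s σ [G2 [k [h2 [s2 [σ2 [l2 -> os2 ->]]]]]].
have le' : t <= ctime G'.
  exact: leq_trans (leq_trans (leq_addr _ _) le) (lock_ctime l2).
(* The first [t] units are taken to be the restriction of [G']; the remaining lock of grade [a]
   serves the smaller clock. *)
have [n' [h' [l' en eh]]] := lock_pra_factor le le' l2.
exists (ctx_minus G' t), (ndropped G' t), (pra le'), (weaken n' \o s2),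
  (fmap (dm C a) σ2 ∘ h'); split.
- exact: lock_pra.
- apply: functional_extensionality => i /=.
  by rewrite weaken_weaken add0n en.
- by exists G2, n', h', s2, σ2.
by rewrite fmap_comp comp_assoc eh -!comp_assoc split_nat.
Qed.

(** [subst_lock] yields only some context lockable for [t]. Factoring its lock through the
    restriction of [G'] leaves a lock of grade 0, that is, a weakening, which is added to the
    substitution. *)
Lemma subst_minus G G' s (σ : hom ⟪G'⟫ ⟪G⟫) t (le : t <= ctime G) :
  subst_ok s σ ->
  exists (le' : t <= ctime G') s1 (σ1 : hom ⟪ctx_minus G' t⟫ ⟪ctx_minus G t⟫),
    [/\ s \o addn (ndropped G t) = weaken (ndropped G' t) \o s1,
        subst_ok s1 σ1
      & fmap (dm C t) σ1 ∘ pra le' = pra le ∘ σ].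
Proof.
move=> os.
have [G1 [n [h [s1 [σ1 [l es os1 eσ]]]]]] := subst_lock (lock_pra C le) os.
have le0 : t + 0 <= t by rewrite addn0.
have le' := lock_ctime l.
have [n' [h' [l' en eh]]] := lock_pra_factor le0 le' l.
exists le', (weaken n' \o s1), (σ1 ∘ (drop ∘ h')); split.
- apply: functional_extensionality => i.
  by rewrite es /= weaken_weaken en.
- exact: subst_weaken l'.
rewrite !fmap_comp 2!comp_assoc eh -(comp_assoc (fmap _ drop)).
have -> : fmap (dm C t) drop ∘ split ⟪G1⟫ le0 = id_.
  have le1 : t <= t + 0 by rewrite addn0.
  rewrite -[LHS]comp_idl -(dm_le_id (leqnn t)) -comp_assoc.
  by rewrite (fmap_drop _ le1) (join_split _ _ _ (leqnn t)).
by rewrite comp_idl.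
Qed.

Lemma subst_typed :
  (forall G V X (d : G ⊢v V : X) G' s (σ : hom ⟪G'⟫ ⟪G⟫), subst_ok s σ ->
     exists d' : G' ⊢v sub_val s V : X, vali C d' = vali C d ∘ σ) /\
  (forall G M X t (d : G ⊢c M : X ! t) G' s (σ : hom ⟪G'⟫ ⟪G⟫), subst_ok s σ ->
     exists d' : G' ⊢c sub_comp s M : X ! t, compi C d' = compi C d ∘ σ).
Proof.
have up X G G' s (σ : hom ⟪G'⟫ ⟪G⟫) (os : subst_ok s σ) := subst_ext X os.
apply: typed_mind.
- move=> G X G' G2 s σ os.
  (* The variable is a lock; pulling it back along [s] yields the substituted value together with
     the lock along which it is weakened. *)
  have [G0 [t [h [l ->]]]] := typed_var_lock (TVar G X G').
  have [G1 [n [h1 [s1 [σ1 [l1 es [_ [d1 K1 e1]] eσ]]]]]] := subst_lock l os.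
  have [_ [d' e']] := Kwk d1 K1 l1.
  have e : sub_val s (Var (nvars G')) = weaken n (s1 0).
    by rewrite -[weaken n _]/((weaken n \o s1) 0) -es /= addn0.
  rewrite e; exists d'; rewrite e' e1 !comp_assoc -eσ.
  by rewrite (comp_lassoc (drop_nat _ _)) !comp_assoc.
- move=> G f Vs dVs IH G' s σ os.
  have [dVs' e] := dependent_choice (fun i => IH i _ _ _ os).
  exists (TConst (f := f) dVs'); rewrite /= comp_assoc tuple_comp.
  by congr (_ ∘ tuple _); apply: functional_extensionality_dep.
- by move=> G G' s σ os; exists (TUnit G'); rewrite /= [RHS]bang_uniq.
- move=> G V W X Y dV IHV dW IHW G' s σ os.
  have [dV' eV] := IHV _ _ _ os; have [dW' eW] := IHW _ _ _ os.
  by exists (TPair dV' dW'); rewrite /= pair_comp eV eW.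
- move=> G X M Y t dM IH G' s σ os; have [dM' e] := IH _ _ _ (up X _ _ _ _ os).
  by exists (TFun dM'); rewrite /= e curry_comp.
- move=> G t V X d IH G' s σ os; have [d' e] := IH _ _ _ (subst_clock t os).
  by exists (TBox d'); rewrite !vali_TBox e boxD_comp.
- move=> G V X d IH G' s σ os; have [d' e] := IH _ _ _ os.
  by exists (TReturn d'); rewrite /= e comp_assoc.
- move=> G M N X Y t t' dM IHM dN IHN G' s σ os.
  have [dM' eM] := IHM _ _ _ os.
  have [dN' eN] := IHN _ _ _ (up X _ _ _ _ (subst_clock t os)).
  by exists (TLet dM' dN'); rewrite !compi_TLet eM eN comp_assoc bindD_comp.
- move=> G V W X Y t dV IHV dW IHW G' s σ os.
  have [dV' eV] := IHV _ _ _ os; have [dW' eW] := IHW _ _ _ os.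
  by exists (TApp dV' dW'); rewrite /= comp_assoc pair_comp eV eW.
- move=> G V N X Y Z t dV IHV dN IHN G' s σ os.
  have [dV' eV] := IHV _ _ _ os.
  have [dN' eN] := IHN _ _ _ (up Y _ _ _ _ (up X _ _ _ _ os)).
  exists (TMatch dV' dN'); rewrite !compi_TMatch eV eN !comp_assoc.
  rewrite (comp_lassoc (alphaV_nat _ _ _)) pmap_id !comp_assoc pmap_pair.
  by rewrite (pair_comp id_) !comp_idl comp_idr.
- move=> G o V M X t dV IHV dM IHM G' s σ os.
  have [dV' eV] := IHV _ _ _ os.
  have [dM' eM] :=
    IHM _ _ _ (up (op_out o) _ _ _ _ (subst_clock (op_time o) os)).
  by exists (TOp dV' dM'); rewrite !compi_TOp eV eM opD_comp.
- move=> G t M X t' d IH G' s σ os; have [d' e] := IH _ _ _ (subst_clock t os).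
  by exists (TDelay d'); rewrite !compi_TDelay e delayD_comp.
- move=> G M H N X Y t t' dM IHM dN IHN dH IHH G' s σ os.
  have [dM' eM] := IHM _ _ _ os.
  have [dN' eN] := IHN _ _ _ (up X _ _ _ _ (subst_clock t os)).
  have [dH' eH] := dependent_choice (fun o => dependent_choice (fun t'' =>
    IHH o t'' _ _ _ (up _ _ _ _ _ (up _ _ _ _ _ os)))).
  exists (THandle dM' dN' dH'); rewrite !compi_THandle eM eN handleD_comp.
  rewrite bindD_comp; congr (handleD _ _).
  rewrite /clausesi tuple_comp; congr tuple.
  apply: functional_extensionality_dep => o; rewrite tuple_comp; congr tuple.
  apply: functional_extensionality_dep => t''.
  by rewrite eH curry_comp !comp_assoc (alphaV_nat _ _ _) pmap_id.
- move=> G t V N X Y t' le dV IHV dN IHN G' s σ os.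
  have [le' [s1 [σ1 [es os1 eσ]]]] := subst_minus le os.
  have [dV' eV] := IHV _ _ _ os1.
  have [dN' eN] := IHN _ _ _ (up X _ _ _ _ os).
  have -> : sub_comp s (Unbox t (weaken (ndropped G t) V) N) =
      Unbox t (weaken (ndropped G' t) (sub_val s1 V)) (sub_comp (up_sub s) N).
    by rewrite /= /weaken (sub_ren S).1 (ren_sub S).1 es.
  exists (TUnbox le' dV' dN').
  rewrite !compi_TUnbox eV eN !comp_assoc; congr (_ ∘ _).
  rewrite pmap_pair pair_comp !comp_idl comp_idr !comp_assoc -eσ.
  by rewrite fmap_comp !comp_assoc.
Qed.
End Substitution.

(** * Renaming first, then weakening and substitution of arbitrary values *)

Section Weakening.
Context (S : signature) (C : model S).
Implicit Types (G : ctx (base_ty S)) (X Y : vty (base_ty S)) (V W : value S)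
  (M N : computation S) (s : nat -> value S).

Notation "⟪ G ⟫" := (ctxi G (one C)) (at level 0, format "⟪ G ⟫").

Let is_var V := exists n, V = Var n.

(** A variable is a lock, and weakening it is composition with another lock. *)
Lemma is_var_weakenable : weakenable C is_var.
Proof.
move=> G1 G t k h V X d [n eV] l; rewrite {}eV in d *.
split; first by exists (k + n).
have [G0 [t0 [h0 [l0 e0]]]] := typed_var_lock C d.
have [d' e'] := lock_var_typed (lock_comp (leqnn (t + t0)) l0 l).
exists d'; rewrite e' e0 !comp_assoc (comp_lassoc (drop_join _ _)) !comp_assoc.
by rewrite (comp_lassoc (drop_nat _ _)) !comp_assoc.
Qed.

(** Weakening is substitution of variables, so the variable instance of [subst_typed] suffices. *)
Lemma all_weakenable : weakenable C (fun=> True).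
Proof.
move=> G1 G t k h V X d _ l; split=> //.
have v0 : is_var (@Var S 0) by exists 0.
have os := subst_weaken is_var_weakenable (subst_id is_var_weakenable v0 G1) l.
have [d' e] := (subst_typed is_var_weakenable v0).1 _ _ _ d _ _ _ os.
by rewrite /weaken -(sub_Var S).1; exists d'; rewrite e comp_idl.
Qed.

Definition denotes G G' s (σ : hom ⟪G'⟫ ⟪G⟫) : Prop :=
  subst_ok (fun=> True) s σ.

Lemma denotes_id G : denotes (@Var S) (idm ⟪G⟫).
Proof. exact: (subst_id all_weakenable I). Qed.

Lemma denotes_weaken G G' G'' s (σ : hom ⟪G'⟫ ⟪G⟫) t k
    (h : hom ⟪G''⟫ (dm C t ⟪G'⟫)) :
  denotes s σ -> lock k h -> denotes (weaken k \o s) (σ ∘ (drop ∘ h)).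
Proof. exact: (subst_weaken all_weakenable). Qed.

Lemma denotes_ext G G' X s (σ : hom ⟪G'⟫ ⟪G⟫) :
  denotes s σ -> denotes (G := G ▹ X) (G' := G' ▹ X) (up_sub s) (σ ×m id_).
Proof. exact: (subst_ext all_weakenable I). Qed.

Lemma denotes_clock G G' t s (σ : hom ⟪G'⟫ ⟪G⟫) :
  denotes s σ ->
  denotes (G := G ⊳⟨ t ⟩) (G' := G' ⊳⟨ t ⟩) s (fmap (dm C t) σ).
Proof. exact: subst_clock. Qed.

Lemma denotes_cons G G' X s V (σ : hom ⟪G'⟫ ⟪G⟫) (d : G' ⊢v V : X) :
  denotes s σ -> denotes (G := G ▹ X) (V .: s) ⟨σ, vali C d⟩.
Proof.
by move=> os; split; rewrite ?fst_pair //; exists d; rewrite ?snd_pair.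
Qed.

Lemma denotes_lock G G1 G' s (σ : hom ⟪G1⟫ ⟪G⟫) t k
    (h : hom ⟪G'⟫ (dm C t ⟪G1⟫)) :
  denotes s σ -> lock k h ->
  denotes (G := G ⊳⟨ t ⟩) (weaken k \o s) (fmap (dm C t) σ ∘ h).
Proof. by move=> os l; exists G1, k, h, s, σ. Qed.

Lemma sub_val_typed G G' s (σ : hom ⟪G'⟫ ⟪G⟫) V X (d : G ⊢v V : X) :
  denotes s σ -> exists d' : G' ⊢v sub_val s V : X, vali C d' = vali C d ∘ σ.
Proof. by move=> os; exact: (subst_typed all_weakenable I).1 os. Qed.

Lemma sub_comp_typed G G' s (σ : hom ⟪G'⟫ ⟪G⟫) M X t (d : G ⊢c M : X ! t) :
  denotes s σ ->
  exists d' : G' ⊢c sub_comp s M : X ! t, compi C d' = compi C d ∘ σ.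
Proof. by move=> os; exact: (subst_typed all_weakenable I).2 os. Qed.
End Weakening.

(** * Uniqueness of typing derivations *)

Section Uniqueness.
Context (S : signature).
Implicit Types (G : ctx (base_ty S)) (X Y : vty (base_ty S)) (V W : value S)
  (M N : computation S).

(** Packing the type with the derivation allows comparing derivations of one term at different
    types, so that types and derivations are shown unique in one induction. *)
Definition vder G V X (d : G ⊢v V : X) : {X & G ⊢v V : X} := existT _ X d.
Definition cder G M X t (d : G ⊢c M : X ! t) :
    {p : vty (base_ty S) * nat & G ⊢c M : p.1 ! p.2} :=
  existT (fun p => G ⊢c M : p.1 ! p.2) (X, t) d.

Lemma vder_inj G V X (d d' : G ⊢v V : X) : vder d = vder d' -> d = d'.
Proof. exact: inj_pair2. Qed.

Lemma cder_inj G M X t (d d' : G ⊢c M : X ! t) : cder d = cder d' -> d = d'.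
Proof.
exact:
  (@inj_pair2 _ (fun p : vty (base_ty S) * nat => G ⊢c M : p.1 ! p.2) (X, t)).
Qed.

Lemma vder_ty G V X X' (d : G ⊢v V : X) (d' : G ⊢v V : X') :
  vder d = vder d' -> X = X'.
Proof. by case. Qed.

Lemma cder_ty G M X X' t t' (d : G ⊢c M : X ! t) (d' : G ⊢c M : X' ! t') :
  cder d = cder d' -> (X, t) = (X', t').
Proof. by case=> -> ->. Qed.

Lemma vtyped_inv G V X (d : G ⊢v V : X) :
  match V return G ⊢v V : X -> Prop with
  | Var n => fun d => exists G0 X0 G', existT
      (fun p : ctx (base_ty S) * nat * vty (base_ty S) =>
         p.1.1 ⊢v Var p.1.2 : p.2) (G, n, X) d
      = existT _ (ctx_cat (G0 ▹ X0) G', nvars G', X0) (TVar G0 X0 G')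
  | Const f Vs => fun d => exists dVs : forall i, G ⊢v Vs i : const_dom i,
      vder d = vder (TConst dVs)
  | Unit => fun d => vder d = vder (TUnit G)
  | Pair V W => fun d => exists Y Z (dV : G ⊢v V : Y) (dW : G ⊢v W : Z),
      vder d = vder (TPair dV dW)
  | Fun Y M => fun d => exists Z t (dM : G ▹ Y ⊢c M : Z ! t),
      vder d = vder (TFun dM)
  | Box t V => fun d => exists Y (dV : G ⊳⟨ t ⟩ ⊢v V : Y),
      vder d = vder (TBox dV)
  end d.
Proof. by case: G V X / d; intros; repeat eexists. Qed.

(** The unbox case also packs the term: its rule yields a weakened value, not an arbitrary one. *)
Lemma ctyped_inv G M X t (d : G ⊢c M : X ! t) :
  match M return G ⊢c M : X ! t -> Prop with
  | Return V => fun d => exists Y (dV : G ⊢v V : Y), cder d = cder (TReturn dV)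
  | Let M N => fun d => exists Y t1 Z t2 (dM : G ⊢c M : Y ! t1)
      (dN : G ⊳⟨ t1 ⟩ ▹ Y ⊢c N : Z ! t2), cder d = cder (TLet dM dN)
  | App V W => fun d => exists Y Z t (dV : G ⊢v V : VArr Y Z t)
      (dW : G ⊢v W : Y), cder d = cder (TApp dV dW)
  | Match V N => fun d => exists Y Z U t (dV : G ⊢v V : VProd Y Z)
      (dN : G ▹ Y ▹ Z ⊢c N : U ! t), cder d = cder (TMatch dV dN)
  | Op o V M => fun d => exists Y t (dV : G ⊢v V : op_in o)
      (dM : G ⊳⟨ op_time o ⟩ ▹ op_out o ⊢c M : Y ! t), cder d = cder (TOp dV dM)
  | Delay u M => fun d => exists Y t (dM : G ⊳⟨ u ⟩ ⊢c M : Y ! t),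
      cder d = cder (TDelay dM)
  | Handle M H N => fun d => exists Y t1 Z t2 (dM : G ⊢c M : Y ! t1)
      (dN : G ⊳⟨ t1 ⟩ ▹ Y ⊢c N : Z ! t2) (dH : htyped G H Z),
      cder d = cder (THandle dM dN dH)
  | Unbox u W N => fun d => exists V, W = weaken (ndropped G u) V /\
      exists Y Z t' (le : u <= ctime G) (dV : ctx_minus G u ⊢v V : VBox u Y)
        (dN : G ▹ Y ⊢c N : Z ! t'),
        existT (fun p : computation S * (vty (base_ty S) * nat) =>
          G ⊢c p.1 : p.2.1 ! p.2.2) (Unbox u W N, (X, t)) d
        = existT _ (_, (_, _)) (TUnbox le dV dN)
  end d.
Proof. by case: G M X t / d; intros; repeat eexists. Qed.

(** Makes the variable rule unambiguous: the index fixes how many variables lie to the right, and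
    the clocks, which it skips, are matched by the contexts themselves. *)
Lemma ctx_cat_inj G1 G2 G1' G2' X1 X2 :
  ctx_cat (G1 ▹ X1) G1' = ctx_cat (G2 ▹ X2) G2' -> nvars G1' = nvars G2' ->
  [/\ G1 = G2, X1 = X2 & G1' = G2'].
Proof.
elim: G1' G2' => [|G1' IH Y|G1' IH u] [|G2' Z|G2' v] //=.
- by case=> -> ->.
- by case=> e -> [] /(IH _ e) [-> -> ->].
by case=> e -> /(IH _ e) [-> -> ->].
Qed.

(** Types are identified first, since [vder_inj] and [cder_inj] compare derivations of one type
    only. *)
Ltac unique IH :=
  let e := fresh "e" in
  have e := IH;
  try ((case: (vder_ty e) + case: (cder_ty e)); intros; subst);
  (move/vder_inj: e + move/cder_inj: e); intros; subst.

Lemma typed_unique :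
  (forall G V X (d : G ⊢v V : X) X' (d' : G ⊢v V : X'), vder d = vder d') /\
  (forall G M X t (d : G ⊢c M : X ! t) X' t' (d' : G ⊢c M : X' ! t'),
     cder d = cder d').
Proof.
apply: typed_mind.
- move=> G X G' X' d'; have [G0 [X0 [G0' e]]] := vtyped_inv d'.
  have [eG en eX] := projT1_eq e. 
  have [? ? ?] := ctx_cat_inj eG en; subst.
  by rewrite (inj_pair2 _ _ _ _ _ e).
- move=> G f Vs dVs IH X' d'; have [dVs' ->] := vtyped_inv d'.
  congr (vder (TConst _)); apply: functional_extensionality_dep => i.
  exact/vder_inj/IH.
- by move=> G X' d'; rewrite (vtyped_inv d').
- move=> G V W X Y dV IHV dW IHW X' d'.
  have [X1 [Y1 [dV' [dW' ->]]]] := vtyped_inv d'.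
  by unique (IHV _ dV'); unique (IHW _ dW').
- move=> G X M Y t dM IH X' d'; have [Y1 [t1 [dM' ->]]] := vtyped_inv d'.
  by unique (IH _ _ dM').
- move=> G t V X dV IH X' d'; have [X1 [dV' ->]] := vtyped_inv d'.
  by unique (IH _ dV').
- move=> G V X dV IH X' t' d'; have [X1 [dV' ->]] := ctyped_inv d'.
  by unique (IH _ dV').
- move=> G M N X Y t t' dM IHM dN IHN X' t'' d'.
  have [X1 [t1 [Y1 [t2 [dM' [dN' ->]]]]]] := ctyped_inv d'.
  by unique (IHM _ _ dM'); unique (IHN _ _ dN').
- move=> G V W X Y t dV IHV dW IHW X' t' d'.
  have [X1 [Y1 [t1 [dV' [dW' ->]]]]] := ctyped_inv d'.
  by unique (IHV _ dV'); unique (IHW _ dW').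
- move=> G V N X Y Z t dV IHV dN IHN X' t' d'.
  have [X1 [Y1 [Z1 [t1 [dV' [dN' ->]]]]]] := ctyped_inv d'.
  by unique (IHV _ dV'); unique (IHN _ _ dN').
- move=> G o V M X t dV IHV dM IHM X' t' d'.
  have [X1 [t1 [dV' [dM' ->]]]] := ctyped_inv d'.
  by unique (IHV _ dV'); unique (IHM _ _ dM').
- move=> G t M X t' dM IHM X' t'' d'; have [X1 [t1 [dM' ->]]] := ctyped_inv d'.
  by unique (IHM _ _ dM').
- move=> G M H N X Y t t' dM IHM dN IHN dH IHH X' t'' d'.
  have [X1 [t1 [Y1 [t2 [dM' [dN' [dH' ->]]]]]]] := ctyped_inv d'.
  unique (IHM _ _ dM'); unique (IHN _ _ dN').
  congr (cder (THandle _ _ _)).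
  apply: functional_extensionality_dep => o.
  apply: functional_extensionality_dep => u.
  exact/cder_inj/IHH.
move=> G t V N X Y t' le dV IHV dN IHN X' t'' d'.
have [V' [/weaken_inj eV [X1 [Y1 [t1 [le' [dV' [dN' e]]]]]]]] := ctyped_inv d'.
subst V'; unique (IHV _ dV'); unique (IHN _ _ dN').
have [eX et] := projT1_eq e; subst.
by rewrite (inj_pair2 _ _ _ _ _ e) (eq_irrelevance le le').
Qed.

Lemma vtyped_unique G V X (d d' : G ⊢v V : X) : d = d'.
Proof. exact/vder_inj/typed_unique.1. Qed.

Lemma ctyped_unique G M X t (d d' : G ⊢c M : X ! t) : d = d'.
Proof. exact/cder_inj/typed_unique.2. Qed.
End Uniqueness.

(** * Soundness *)

Scheme veq_mind := Induction for veq Sort Prop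
  with ceq_mind := Induction for ceq Sort Prop.
Combined Scheme eq_mind from veq_mind, ceq_mind.

Section Equations.
Context (S : signature) (C : model S).
Implicit Types (G : ctx (base_ty S)) (X Y Z : vty (base_ty S)) (V W U : value S)
  (M N P : computation S).

Notation "⟦ X ⟧" := (tyi (@basei S C) X) (at level 0, format "⟦ X ⟧").
Notation "⟪ G ⟫" := (ctxi G (one C)) (at level 0, format "⟪ G ⟫").
Notation pra := (eta_pra (one C)).

Lemma gcast_comp (F : nat -> C) m n p (e : m = n) (e' : n = p) :
  gcast F e' ∘ gcast F e = gcast F (etrans e e').
Proof. by subst; rewrite comp_idl. Qed.

(** The two sides of a commuting axiom come with differently bracketed grades; this cast of
    derivations meets the [gcast] in the model's laws. *)
Lemma cast_typed G M X t t' (e : t = t') (d : G ⊢c M : X ! t) :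
  exists d' : G ⊢c M : X ! t',
    compi C d' = gcast (fun s => T C s ⟦X⟧) e ∘ compi C d.
Proof. by subst t'; exists d; rewrite comp_idl. Qed.

Lemma sub_comp_id M : sub_comp (@Var S) M = M.
Proof. by rewrite -[RHS](ren_id S).2 -(sub_Var S).2. Qed.

Lemma weakenE n V : weaken n V = sub_val (weaken n \o @Var S) V.
Proof. by rewrite /weaken -(sub_Var S).1. Qed.

Lemma lift1E M : lift1 M = sub_comp (up_sub (weaken 1 \o @Var S)) M.
Proof.
rewrite /lift1 -(sub_Var S).2; congr sub_comp.
by apply: functional_extensionality => -[].
Qed.

Lemma lift2E M : lift2 M = sub_comp (up_sub (up_sub (weaken 1 \o @Var S))) M.
Proof.
rewrite /lift2 -(sub_Var S).2; congr sub_comp.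
by apply: functional_extensionality => -[|[]].
Qed.

Lemma weaken_typed G G1 t n (h : hom ⟪G⟫ (dm C t ⟪G1⟫)) V X (d : G1 ⊢v V : X) :
  lock n h ->
  exists d' : G ⊢v weaken n V : X, vali C d' = vali C d ∘ (drop ∘ h).
Proof. by move=> l; case: (all_weakenable d I l). Qed.

Lemma clauses_typed G G' s (σ : hom ⟪G'⟫ ⟪G⟫) H Y (dH : htyped G H Y) :
  denotes s σ ->
  exists dH' : htyped G' (fun o => sub_comp (up_sub (up_sub s)) (H o)) Y,
    clausesi C dH' = clausesi C dH ∘ σ.
Proof.
move=> os.
have [dH' e] := dependent_choice (fun o => dependent_choice (fun t'' =>
  sub_comp_typed (dH o t'') (denotes_ext _ (denotes_ext _ os)))).
exists dH'; rewrite /clausesi tuple_comp; congr tuple.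
apply: functional_extensionality_dep => o; rewrite tuple_comp; congr tuple.
apply: functional_extensionality_dep => t''; rewrite e curry_comp !comp_assoc.
by rewrite alphaV_nat pmap_id.
Qed.

(** This and the next four substitutions change no variable beyond a shift, only the clocks around
    it; they retype the continuations and clauses that the axioms move. *)
Lemma denotes_now G :
  denotes (C := C) (G := G ⊳⟨ 0 ⟩) (G' := G) (@Var S) (eta _).
Proof.
have := denotes_lock (denotes_id C G) (lock_refl C G).
by rewrite fmap_id comp_idl.
Qed.

Lemma denotes_clock_id G t :
  denotes (G := G) (G' := G ⊳⟨ t ⟩) (@Var S) (@drop C _ t).
Proof.
have le : t <= t + 0 by rewrite addn0.
have := denotes_weaken (denotes_id C G) (lock_clock le (lock_refl C G)).
by rewrite (join_eta2 _ _ (leqnn t)) dm_le_id comp_idr comp_idl.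
Qed.

Lemma denotes_join G t t' (le : t + t' <= t' + t) :
  denotes (G := G ⊳⟨ t + t' ⟩) (G' := G ⊳⟨ t ⟩ ⊳⟨ t' ⟩) (@Var S) (join ⟪G⟫ le).
Proof.
have le0 : t <= t + 0 by rewrite addn0.
have := denotes_lock (denotes_id C G)
  (lock_clock le (lock_clock le0 (lock_refl C G))).
by rewrite (join_eta2 _ _ (leqnn t)) dm_le_id !fmap_id comp_idr comp_idl.
Qed.

Lemma denotes_join1 G t t' X (le : t + t' <= t' + t) :
  denotes (G := G ⊳⟨ t + t' ⟩) (G' := G ⊳⟨ t ⟩ ▹ X ⊳⟨ t' ⟩)
    (weaken 1 \o @Var S) (join ⟪G⟫ le ∘ fmap (dm C t') fst).
Proof.
have le0 : t <= t + 0 by rewrite addn0.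
have := denotes_lock (denotes_id C G)
  (lock_clock le (lock_var X (lock_clock le0 (lock_refl C G)))).
by rewrite (join_eta2 _ _ (leqnn t)) dm_le_id !comp_idl fmap_id comp_idl.
Qed.

Lemma denotes_clock1 G t X :
  denotes (G := G) (G' := G ⊳⟨ t ⟩ ▹ X) (weaken 1 \o @Var S)
    (@drop C _ t ∘ fst).
Proof.
have le : t <= t + 0 by rewrite addn0.
have := denotes_weaken (denotes_id C G)
  (lock_var X (lock_clock le (lock_refl C G))).
by rewrite (join_eta2 _ _ (leqnn t)) dm_le_id !comp_idl.
Qed.

Lemma denotes_at G X G' V (d : G ⊢v V : X) :
  exists σ, denotes (C := C) (G := ctx_cat (G ▹ X) G') (G' := ctx_cat G G')
    (sub_at (nvars G') V) σ.
Proof.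
elim: G' => [|G' [σ os] Y|G' [σ os] t] /=.
- by exists ⟨id_, vali C d⟩; apply: denotes_cons (denotes_id _ _).
- by exists (σ ×m id_); apply: denotes_ext.
by exists (fmap (dm C t) σ); apply: denotes_clock.
Qed.

(** Existential, so that the presupposed typings come out of the induction on equations. *)
Definition vsound G V W X : Prop :=
  exists (dV : G ⊢v V : X) (dW : G ⊢v W : X), vali C dV = vali C dW.
Definition csound G M N X t : Prop :=
  exists (dM : G ⊢c M : X ! t) (dN : G ⊢c N : X ! t), compi C dM = compi C dN.

Lemma VFunEta_sound G V X Y t : G ⊢v V : VArr X Y t ->
  vsound G (Fun X (App (weaken 1 V) (Var 0))) V (VArr X Y t).
Proof.
move=> dV.
have [dV' eV] := weaken_typed dV (lock_var X (lock_refl C G)).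
have [d0 e0] := lock_var_typed (lock_refl C (G ▹ X)).
exists (TFun (TApp dV' d0)), dV; rewrite /= eV e0.
rewrite (comp_lassoc (drop_eta _)) comp_idl drop_eta comp_idr.
by rewrite -uncurry_pair pair_fst_snd comp_idr uncurryK.
Qed.

Lemma CFunBeta_sound G X M V Y t : G ▹ X ⊢c M : Y ! t -> G ⊢v V : X ->
  csound G (App (Fun X M) V) (inst M V) Y t.
Proof.
move=> dM dV.
have [d e] := sub_comp_typed dM (denotes_cons dV (denotes_id C G)).
by exists (TApp (TFun dM) dV), d; rewrite e /= -ev_curry comp_idr.
Qed.

Lemma CMatchBeta_sound G V W N X Y Z t : G ⊢v V : X -> G ⊢v W : Y ->
  G ▹ X ▹ Y ⊢c N : Z ! t ->
  csound G (Match (Pair V W) N) (sub_comp (W .: V .: @Var S) N) Z t.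
Proof.
move=> dV dW dN.
have [d e] :=
  sub_comp_typed dN (denotes_cons dW (denotes_cons dV (denotes_id C G))).
exists (TMatch (TPair dV dW) dN), d.
by rewrite e compi_TMatch /= alphaV_pair.
Qed.

Lemma CMatchEta_sound G V N X Y Z t : G ⊢v V : VProd X Y ->
  G ▹ VProd X Y ⊢c N : Z ! t ->
  csound G (Match V (sub_comp (Pair (Var 1) (Var 0) .: (fun n => Var n.+2)) N))
    (inst N V) Z t.
Proof.
move=> dV dN.
have [d e] := sub_comp_typed dN (denotes_cons dV (denotes_id C G)).
have [d0 e0] := lock_var_typed (lock_refl C (G ▹ X ▹ Y)).
have [d1 e1] := lock_var_typed (lock_var Y (lock_refl C (G ▹ X))).
have w := denotes_weaken (denotes_id C G)
  (lock_var Y (lock_var X (lock_refl C G))).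
have [d' e'] := sub_comp_typed dN (denotes_cons (TPair d1 d0) w).
exists (TMatch dV d'), d; rewrite e compi_TMatch e' comp_assoc; congr (_ ∘ _).
rewrite /= e0 e1 drop_eta comp_idr !(comp_lassoc (drop_eta _)) !comp_idl.
rewrite !comp_assoc (comp_lassoc (drop_eta _)) comp_idl.
have -> : ⟨id_, vali C dV⟩ = ⟨idm ⟪G⟫, ⟨fst ∘ vali C dV, snd ∘ vali C dV⟩⟩.
  by rewrite -pair_uniq.
by rewrite alphaV_pair alpha_pair.
Qed.

Lemma CLetReturn_sound G V N X Y t : G ⊢v V : X -> G ⊳⟨ 0 ⟩ ▹ X ⊢c N : Y ! t ->
  csound G (Let (Return V) N) (inst N V) Y t.
Proof.
move=> dV dN.
have [d e] := sub_comp_typed dN (denotes_cons dV (denotes_now G)).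
exists (TLet (TReturn dV) dN), d.
rewrite (compi_TLet C (TReturn dV) dN) bindD_etaT e.
by rewrite -comp_assoc muT_eta gcast_id comp_idl.
Qed.

Lemma CLetLet_sound G M N P X Y Z t t' t'' : G ⊢c M : X ! t ->
  G ⊳⟨ t ⟩ ▹ X ⊢c N : Y ! t' -> G ⊳⟨ t + t' ⟩ ▹ Y ⊢c P : Z ! t'' ->
  csound G (Let (Let M N) P) (Let M (Let N (lift1 P))) Z (t + t' + t'').
Proof.
move=> dM dN dP; have le : t + t' <= t' + t by rewrite addnC.
have [dP' eP] := sub_comp_typed dP (denotes_ext Y (denotes_join1 G X le)).
rewrite -lift1E in dP' eP.
have [d e] := cast_typed (addnA t t' t'') (TLet dM (TLet dN dP')).
exists (TLet (TLet dM dN) dP), d; rewrite e !compi_TLet (bindD_muT le).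
rewrite bindD_bindD -comp_assoc muT_muT !comp_assoc; congr (_ ∘ (_ ∘ _)).
rewrite fmap_bindD bindD_comp snd_pair !comp_assoc pmap_comp comp_assoc.
by rewrite -fmap_comp fst_pair comp_idl eP.
Qed.

Lemma CLetEta_sound G M X t : G ⊢c M : X ! t ->
  csound G (Let M (Return (Var 0))) M X t.
Proof.
move=> dM; have [d0 e0] := lock_var_typed (lock_refl C (G ⊳⟨ t ⟩ ▹ X)).
have [d e] := cast_typed (addn0 t) (TLet dM (TReturn d0)).
exists d, dM.
rewrite e compi_TLet /= e0 drop_eta comp_idr -fmap_bindD bindD_snd.
(* The model's cast from [t] to [t + 0] cancels against that of the derivation. *)
rewrite -(comp_assoc (muT _ _ _)) muT_fmap_eta -comp_assoc gcast_comp gcast_id.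
exact: comp_idl.
Qed.

Lemma CLetOp_sound G o V M N X Y t t' : G ⊢v V : op_in o ->
  G ⊳⟨ op_time o ⟩ ▹ op_out o ⊢c M : X ! t ->
  G ⊳⟨ op_time o + t ⟩ ▹ X ⊢c N : Y ! t' ->
  csound G (Let (Op o V M) N) (Op o V (Let M (lift1 N))) Y (op_time o + t + t').
Proof.
move=> dV dM dN; have le : op_time o + t <= t + op_time o by rewrite addnC.
have [dN' eN] :=
  sub_comp_typed dN (denotes_ext X (denotes_join1 G (op_out o) le)).
rewrite -lift1E in dN' eN.
have [d e] := cast_typed (addnA _ t t') (TOp dV (TLet dM dN')).
exists (TLet (TOp dV dM) dN), d; rewrite e compi_TLet !compi_TOp (bindD_opD le).
by rewrite muT_opD compi_TLet eN.
Qed.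

Lemma CLetDelay_sound G M N X Y t t' t'' : G ⊳⟨ t ⟩ ⊢c M : X ! t' ->
  G ⊳⟨ t + t' ⟩ ▹ X ⊢c N : Y ! t'' ->
  csound G (Let (Delay t M) N) (Delay t (Let M N)) Y (t + t' + t'').
Proof.
move=> dM dN; have le : t + t' <= t' + t by rewrite addnC.
have [dN' eN] := sub_comp_typed dN (denotes_ext X (denotes_join G le)).
rewrite up_sub_Var sub_comp_id in dN' eN.
have [d e] := cast_typed (addnA _ t' t'') (TDelay (TLet dM dN')).
exists (TLet (TDelay dM) dN), d; rewrite e compi_TLet !compi_TDelay.
by rewrite (bindD_delayD le) muT_delayD compi_TLet eN.
Qed.

Lemma CHandleReturn_sound G V H N X Y t : G ⊢v V : X -> htyped G H Y ->
  G ⊳⟨ 0 ⟩ ▹ X ⊢c N : Y ! t ->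
  csound G (Handle (Return V) H N) (inst N V) Y t.
Proof.
move=> dV dH dN.
have [d e] := sub_comp_typed dN (denotes_cons dV (denotes_now G)).
exists (THandle (TReturn dV) dN dH), d.
rewrite (compi_THandle C (TReturn dV) dN dH) bindD_etaT e.
by rewrite handleD_etaT.
Qed.

Lemma CHandleOp_sound G o V M H N X Y t t' : G ⊢v V : op_in o ->
  G ⊳⟨ op_time o ⟩ ▹ op_out o ⊢c M : X ! t -> htyped G H Y ->
  G ⊳⟨ op_time o + t ⟩ ▹ X ⊢c N : Y ! t' ->
  csound G (Handle (Op o V M) H N)
    (sub_comp (Box (op_time o)
       (Fun (op_out o) (Handle M (fun o' => lift2 (H o')) (lift1 N)))
       .: V .: @Var S) (H o)) Y (op_time o + t + t').
Proof.
move=> dV dM dH dN; have le : op_time o + t <= t + op_time o by rewrite addnC.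
have [dN' eN] :=
  sub_comp_typed dN (denotes_ext X (denotes_join1 G (op_out o) le)).
rewrite -lift1E in dN' eN.
have [dH' eH] := clauses_typed dH (denotes_clock1 G (op_time o) (op_out o)).
have eH2 : (fun o' => sub_comp (up_sub (up_sub (weaken 1 \o @Var S))) (H o')) =
    (fun o' => lift2 (H o')).
  by apply: functional_extensionality => o'; rewrite lift2E.
rewrite {}eH2 in dH' eH.
have os := denotes_cons (TBox (TFun (THandle dM dN' dH')))
  (denotes_cons dV (denotes_id C G)).
(* The resumption has grade [t + t'], which selects the instance of the clause. *)
have [d0 e0] := sub_comp_typed (dH o (t + t')) os.
have [d e] := cast_typed (addnA _ t t') d0.
exists (THandle (TOp dV dM) dN dH), d; rewrite e e0 compi_THandle compi_TOp.
rewrite (bindD_opD le) handleD_opD; congr (_ ∘ _).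
rewrite proj_clausesi -[curry _]comp_idr ev_curry comp_assoc alphaV_pair.
by rewrite vali_TBox vali_TFun compi_THandle eH eN.
Qed.

Lemma CHandleDelay_sound G M H N X Y t t' t'' : G ⊳⟨ t ⟩ ⊢c M : X ! t' ->
  htyped G H Y -> G ⊳⟨ t + t' ⟩ ▹ X ⊢c N : Y ! t'' ->
  csound G (Handle (Delay t M) H N) (Delay t (Handle M H N)) Y (t + t' + t'').
Proof.
move=> dM dH dN; have le : t + t' <= t' + t by rewrite addnC.
have [dN' eN] := sub_comp_typed dN (denotes_ext X (denotes_join G le)).
rewrite up_sub_Var sub_comp_id in dN' eN.
have [dH' eH] := clauses_typed dH (denotes_clock_id G t).
have eH2 : (fun o => sub_comp (up_sub (up_sub (@Var S))) (H o)) = H.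
  by apply: functional_extensionality => o; rewrite !up_sub_Var sub_comp_id.
rewrite {}eH2 in dH' eH.
have [d e] := cast_typed (addnA _ t' t'') (TDelay (THandle dM dN' dH')).
exists (THandle (TDelay dM) dN dH), d; rewrite e compi_THandle !compi_TDelay.
by rewrite (bindD_delayD le) handleD_delayD compi_THandle eN eH.
Qed.

Lemma CUnboxBeta_sound G t V N X Y t' : t <= ctime G ->
  ctx_minus G t ⊳⟨ t ⟩ ⊢v V : X -> G ▹ X ⊢c N : Y ! t' ->
  csound G (Unbox t (weaken (ndropped G t) (Box t V)) N)
    (inst N (weaken (ndropped G t) V)) Y t'.
Proof.
move=> le dV dN.
(* The restriction, read as a substitution, fills the clock of the box with the time elapsed in
   [G]. *)
have os := denotes_lock (denotes_id C _) (lock_pra C le).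
have [dV' eV] := sub_val_typed dV os; rewrite -weakenE in dV' eV.
have [d e] := sub_comp_typed dN (denotes_cons dV' (denotes_id C G)).
exists (TUnbox le (TBox dV) dN), d.
rewrite compi_TUnbox e eV fmap_id comp_idl vali_TBox.
by rewrite -(comp_assoc (adj_counit _ _)) counit_boxD.
Qed.

Lemma CUnboxEta_sound G t V N X Y t' : t <= ctime G ->
  ctx_minus G t ⊢v V : VBox t X -> G ▹ VBox t X ⊢c N : Y ! t' ->
  csound G (Unbox t (weaken (ndropped G t) V)
      (sub_comp (Box t (Var 0) .: (fun n => Var n.+1)) N))
    (inst N (weaken (ndropped G t) V)) Y t'.
Proof.
move=> le dV dN.
have [dV' eV] := weaken_typed dV (lock_pra C le).
have [d e] := sub_comp_typed dN (denotes_cons dV' (denotes_id C G)).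
have let0 : t <= t + 0 by rewrite addn0.
(* In the expanded term the unboxed variable stands under the clock of the new box. *)
have [d0 e0] := lock_var_typed (lock_clock let0 (lock_refl C (G ▹ X))).
have w := denotes_weaken (denotes_id C G) (lock_var X (lock_refl C G)).
have [dN' eN] := sub_comp_typed dN (denotes_cons (TBox d0) w).
exists (TUnbox le dV dN'), d.
rewrite compi_TUnbox e eN comp_assoc; congr (_ ∘ _).
rewrite vali_TBox e0 eV (join_eta2 _ _ (leqnn t)) dm_le_id comp_idr.
rewrite (comp_lassoc (drop_eta _)) !comp_idl -drop_nat -boxD_comp.
rewrite pair_comp fst_pair comp_assoc snd_pair boxD_drop.
rewrite (comp_lassoc (bx_le_counit _ _)) (comp_lassoc (drop_nat _ _)).
by rewrite !comp_assoc.
Qed.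

Lemma eq_sound :
  (forall G V W X, G ⊢v V ≡ W : X -> vsound G V W X) /\
  (forall G M N X t, G ⊢c M ≡ N : X ! t -> csound G M N X t).
Proof.
apply: eq_mind; rewrite /vsound /csound.
- by move=> G V X d; exists d, d.
- by move=> G V W X _ [dV [dW e]]; exists dW, dV.
- move=> G V W U X _ [dV [dW e]] _ [dW' [dU e']]; exists dV, dU.
  (* The two hypotheses bring their own derivations of the middle term. *)
  by rewrite e (vtyped_unique dW dW').
- move=> G f Vs Ws _ IH.
  have [dVs IH'] := dependent_choice IH.
  have [dWs e] := dependent_choice IH'.
  exists (TConst (f := f) dVs), (TConst (f := f) dWs).
  by congr (_ ∘ tuple _); apply: functional_extensionality_dep.
- move=> G V V' W W' X Y _ [dV [dV' eV]] _ [dW [dW' eW]].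
  by exists (TPair dV dW), (TPair dV' dW'); congr ⟨_, _⟩.
- by move=> G X M N Y t _ [dM [dN e]]; exists (TFun dM), (TFun dN); congr curry.
- move=> G t V W X _ [dV [dW e]]; exists (TBox dV), (TBox dW).
  by rewrite !vali_TBox e.
- move=> G X G' V W U Y _ [dV [dW e]] dU.
  have [σ os] := denotes_at G' dU.
  have [dV' eV] := sub_val_typed dV os; have [dW' eW] := sub_val_typed dW os.
  by exists dV', dW'; rewrite eV eW e.
- by move=> G V d; exists (TUnit G), d; rewrite [RHS]bang_uniq.
- exact: VFunEta_sound.
- by move=> G M X t d; exists d, d.
- by move=> G M N X t _ [dM [dN e]]; exists dN, dM.
- move=> G M N P X t _ [dM [dN e]] _ [dN' [dP e']]; exists dM, dP.
  by rewrite e (ctyped_unique dN dN').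
- move=> G V W X _ [dV [dW e]]; exists (TReturn dV), (TReturn dW).
  by congr (_ ∘ _).
- move=> G M M' N N' X Y t t' _ [dM [dM' eM]] _ [dN [dN' eN]].
  by exists (TLet dM dN), (TLet dM' dN'); rewrite !compi_TLet eM eN.
- move=> G V V' W W' X Y t _ [dV [dV' eV]] _ [dW [dW' eW]].
  by exists (TApp dV dW), (TApp dV' dW'); congr (_ ∘ ⟨_, _⟩).
- move=> G V V' N N' X Y Z t _ [dV [dV' eV]] _ [dN [dN' eN]].
  by exists (TMatch dV dN), (TMatch dV' dN'); rewrite !compi_TMatch eV eN.
- move=> G o V V' M M' X t _ [dV [dV' eV]] _ [dM [dM' eM]].
  by exists (TOp dV dM), (TOp dV' dM'); rewrite !compi_TOp eV eM.
- move=> G t M M' X t' _ [dM [dM' eM]].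
  by exists (TDelay dM), (TDelay dM'); rewrite !compi_TDelay eM.
- move=> G M M' H H' N N' X Y t t' _ [dM [dM' eM]] _ [dN [dN' eN]] _ IH.
  have [dH IH'] := dependent_choice (fun o => dependent_choice (IH o)).
  have [dH' eH] := dependent_choice (fun o => dependent_choice (IH' o)).
  exists (THandle dM dN dH), (THandle dM' dN' dH').
  rewrite !compi_THandle eM eN.
  congr (handleD (tuple _) _); apply: functional_extensionality_dep => o.
  by congr tuple; apply: functional_extensionality_dep => t''; rewrite eH.
- move=> G t V W N N' X Y t' le _ [dV [dW eV]] _ [dN [dN' eN]].
  by exists (TUnbox le dV dN), (TUnbox le dW dN'); rewrite !compi_TUnbox eV eN.
- move=> G X G' M N U Y t _ [dM [dN e]] dU.
  have [σ os] := denotes_at G' dU.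
  have [dM' eM] := sub_comp_typed dM os; have [dN' eN] := sub_comp_typed dN os.
  by exists dM', dN'; rewrite eM eN e.
- exact: CFunBeta_sound.
- exact: CMatchBeta_sound.
- exact: CMatchEta_sound.
- exact: CLetReturn_sound.
- exact: CLetLet_sound.
- exact: CLetEta_sound.
- exact: CLetOp_sound.
- exact: CLetDelay_sound.
- exact: CHandleReturn_sound.
- exact: CHandleOp_sound.
- exact: CHandleDelay_sound.
- exact: CUnboxBeta_sound.
- exact: CUnboxEta_sound.
Qed.
End Equations.

(* Typing derivations are data, and the interpretation is defined on them; the
   two derivations quantified over are the presupposed typings of both sides. *)
Theorem theorem3 (S : signature) (C : model S) :
  (forall (G : ctx (base_ty S)) (V W : value S) (X : vty (base_ty S))
          (dV : G ⊢v V : X) (dW : G ⊢v W : X),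
     G ⊢v V ≡ W : X -> vali C dV = vali C dW) /\
  (forall (G : ctx (base_ty S)) (M N : computation S) (X : vty (base_ty S))
          (t : nat) (dM : G ⊢c M : X ! t) (dN : G ⊢c N : X ! t),
     G ⊢c M ≡ N : X ! t -> compi C dM = compi C dN).
Proof.
have [veq_sound ceq_sound] := eq_sound C; split.
  move=> G V W X dV dW /veq_sound [dV' [dW' e]].
  by rewrite (vtyped_unique dV dV') (vtyped_unique dW dW').
move=> G M N X t dM dN /ceq_sound [dM' [dN' e]].
by rewrite (ctyped_unique dM dM') (ctyped_unique dN dN').
Qed.
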